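(* Let $\eta>0$ be the penalty parameter and let $w^o(\eta)$ be the unique minimizer over $\mathbb{R}^M$ of $J^{\mathrm{glob}}_\eta(w)=\sum_{k=1}^NJ_k(w)+\eta\sum_{k=1}^Np_k(w)$. Assume: (i) for each $k=1,\dots,N$ there are $\lambda_{k,\min}>0$ and $\lambda_{k,\max}>0$ with $\lambda_{k,\min}I_M\le\nabla_w^2J_k(w)\le\lambda_{k,\max}I_M$ for all $w\in\mathbb{R}^M$; (ii) for each $k=1,\dots,N$ there is $\lambda^p_{k,\max}>0$ with $0\le\nabla_w^2p_k(w)\le\lambda^p_{k,\max}I_M$ for all $w\in\mathbb{R}^M$; (iii) the combination matrix $A$ is primitive and doubly stochastic; (iv) the gradient noise satisfies the model described in the context for some constants $\alpha\ge0$, $\sigma_v^2\ge0$. Then the penalized diffusion strategy described in the context converges for sufficiently small positive step-sizes, namely, for step-sizes $\mu>0$ that satisfy $$\mu<\min_{1\le k\le N}\left\{\frac{2\lambda_{k,\max}}{\lambda_{k,\max}^2+2\alpha},\ \frac{2\lambda_{k,\min}}{\lambda_{k,\min}^2+2\alpha},\ \frac{2}{\eta\cdot\lambda^p_{k,\max}}\right\}.$$ Specifically, it holds that for small $\mu$ (for each agent $k$) $$\limsup_{i\to\infty}\ \mathbb{E}\|w^o(\eta)-\boldsymbol{w}_{k,i}\|^2\le O(\mu)+O((\eta\cdot\mu)^2),$$ so that $$\lim_{\mu\to0}\ \limsup_{i\to\infty}\ \mathbb{E}\|w^o(\eta)-\boldsymbol{w}_{k,i}\|^2=0.$$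
   Context: Costs and penalties. There are $N$ agents in a network; $\mathcal{N}_k$ is the neighborhood of agent $k$ (including $k$). Agent $k$ has a strongly convex cost $J_k:\mathbb{R}^M\to\mathbb{R}$, with Hessian matrix $\nabla_w^2J_k$, and a convex constraint set $$\mathbb{W}_k=\{w\in\mathbb{R}^M: h_{k,u}(w)=0,\ u=1,\dots,U_k;\ g_{k,l}(w)\le0,\ l=1,\dots,L_k\},$$ with $h_{k,u}$ affine and $g_{k,l}$ convex. Put $\mathbb{W}=\mathbb{W}_1\cap\cdots\cap\mathbb{W}_N$. The penalty functions are $$p_k(w)=\sum_{l=1}^{L_k}\delta^{\mathrm{IP}}(g_{k,l}(w))+\sum_{u=1}^{U_k}\delta^{\mathrm{EP}}(h_{k,u}(w)),$$ where $\delta^{\mathrm{IP}},\delta^{\mathrm{EP}}:\mathbb{R}\to\mathbb{R}$ are continuous convex functions with $\delta^{\mathrm{IP}}(x)=0$ for $x\le0$, $\delta^{\mathrm{IP}}(x)>0$ for $x>0$, $\delta^{\mathrm{EP}}(0)=0$, $\delta^{\mathrm{EP}}(x)>0$ for $x\neq0$, selected so that $\nabla_wp_k(w')=0$ whenever $w'\in\mathbb{W}$; the $p_k$ are convex and have Hessian matrices $\nabla_w^2p_k$. Penalized diffusion strategy. Let $A=[a_{\ell k}]$ be an $N\times N$ matrix with nonnegative entries and $a_{\ell k}=0$ if $\ell\notin\mathcal{N}_k$. Let either $(A_1,A_2)=(I_N,A)$ (Adapt-then-Combine) or $(A_1,A_2)=(A,I_N)$ (Combine-then-Adapt), with entries $a_{1,\ell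 k}$ and $a_{2,\ell k}$. With constant step-size $\mu>0$ and penalty parameter $\eta>0$, starting from initial iterates $\boldsymbol{w}_{k,0}\in\mathbb{R}^M$, each agent $k$ iterates, for $i\ge1$, $$\boldsymbol{\phi}_{k,i-1}=\sum_{\ell\in\mathcal{N}_k}a_{1,\ell k}\boldsymbol{w}_{\ell,i-1},\qquad \boldsymbol{\zeta}_{k,i}=\boldsymbol{\phi}_{k,i-1}-\mu\,\widehat{\nabla_w}J_k(\boldsymbol{\phi}_{k,i-1}),$$ $$\boldsymbol{\psi}_{k,i}=\boldsymbol{\zeta}_{k,i}-\mu\eta\,\nabla_wp_k(\boldsymbol{\zeta}_{k,i}),\qquad \boldsymbol{w}_{k,i}=\sum_{\ell\in\mathcal{N}_k}a_{2,\ell k}\boldsymbol{\psi}_{\ell,i}.$$ Gradient noise model. The perturbed gradient vector at iteration $i$ is $\widehat{\nabla_w}J_k(\boldsymbol{w})=\nabla_wJ_k(\boldsymbol{w})+\boldsymbol{v}_{k,i}(\boldsymbol{w})$, where, with $\mathcal{H}_{i-1}=\{\boldsymbol{w}_{k,j}:k=1,\dots,N\text{ and }j\le i-1\}$ denoting the past history of the iterates, the gradient noise satisfies $$\mathbb{E}\{\boldsymbol{v}_{k,i}(\boldsymbol{w})\mid\mathcal{H}_{i-1}\}=0,\qquad \mathbb{E}\|\boldsymbol{v}_{k,i}(\boldsymbol{w})\|^2\le\alpha\,\mathbb{E}\|\boldsymbol{w}\|^2+\sigma_v^2$$ for $\boldsymbol{w}\in\mathcal{H}_{i-1}$, meaning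 random vectors $\boldsymbol{w}$ determined by the past history (such as $\boldsymbol{\phi}_{k,i-1}$). Conventions. A doubly stochastic matrix has nonnegative entries with all row and column sums equal to one; a nonnegative matrix is primitive if some power of it is entrywise positive. For symmetric matrices, $X\le Y$ means $Y-X$ is positive semidefinite; $\|\cdot\|$ is the Euclidean norm; $\mathbb{E}$ is expectation. *)

(* Defs.v *)
(* MathComp-Analysis; elements of R^M are row vectors 'rV[R]_M. *)
From HB Require Import structures.
From mathcomp Require Import all_boot all_order all_algebra.
From mathcomp Require Import all_classical all_reals all_analysis.

Set Implicit Arguments.
Unset Strict Implicit.
Unset Printing Implicit Defensive.

Import Order.TTheory GRing.Theory Num.Theory.
Import numFieldNormedType.Exports.

Local Open Scope classical_set_scope.
Local Open Scope ring_scope.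

Section Euclidean.
Context {R : realType} {M : nat}.
Implicit Types (x y : 'rV[R]_M) (X Y : 'M[R]_M) (f : 'rV[R]_M -> R).

Definition dotp x y : R := (x *m y^T) 0 0.

(* The norm `|x| of MathComp-Analysis on 'rV[R]_M is the sup norm; it is only
   used for the topology, for which the choice of norm is irrelevant. *)
Definition l2norm x : R := Num.sqrt (dotp x x).

Definition psd X : Prop := X^T = X /\ forall x, 0 <= dotp (x *m X) x.

Definition loewner_le X Y : Prop := psd (Y - X).

Definition grad f (w : 'rV[R]_M) : 'rV[R]_M :=
  \row_j 'D_(delta_mx 0 j) (f : _ -> R^o) w.

Definition hess f (w : 'rV[R]_M) : 'M[R]_M := 'J (grad f) w.

(* The derivative operators are total, so differentiability must be assumed
   separately for grad and hess to be meaningful. *)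
Definition twice_differentiable f : Prop :=
  (forall w, differentiable (f : _ -> R^o) w) /\
  (forall w, differentiable (grad f) w).

Definition convex_fun f : Prop := convex_function [set: 'rV[R]_M] f.

Definition strongly_convex f : Prop :=
  exists2 m : R, 0 < m & forall x y (t : R), 0 <= t <= 1 ->
    f (t *: x + (1 - t) *: y) <=
    t * f x + (1 - t) * f y - m / 2 * t * (1 - t) * l2norm (x - y) ^+ 2.

Definition affine_fun f : Prop :=
  exists a : 'rV[R]_M, exists b : R, forall x, f x = dotp a x + b.

Definition unique_minimizer f x : Prop := forall y, y != x -> f x < f y.

End Euclidean.

Section Penalties.
Context {R : realType} {N M : nat} {U L : 'I_N -> nat}.
Variables (h : forall k, 'I_(U k) -> 'rV[R]_M -> R)
  (g : forall k, 'I_(L k) -> 'rV[R]_M -> R).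

Definition feasible (k : 'I_N) : set 'rV[R]_M :=
  [set w | (forall u, h (k := k) u w = 0) /\ (forall l, g (k := k) l w <= 0)].

Definition global_feasible : set 'rV[R]_M := \bigcap_k feasible k.

Variables dIP dEP : R -> R.

Definition inequality_penalty : Prop :=
  [/\ continuous dIP, convex_function [set: R^o] dIP,
      forall x, x <= 0 -> dIP x = 0 & forall x, 0 < x -> 0 < dIP x].

Definition equality_penalty : Prop :=
  [/\ continuous dEP, convex_function [set: R^o] dEP,
      dEP 0 = 0 & forall x, x != 0 -> 0 < dEP x].

Definition penalty (k : 'I_N) (w : 'rV[R]_M) : R :=
  \sum_(l < L k) dIP (g l w) + \sum_(u < U k) dEP (h u w).

End Penalties.

Definition glob_cost {R : realType} {N M : nat} (J p : 'I_N -> 'rV[R]_M -> R)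
    (eta : R) (w : 'rV[R]_M) : R :=
  \sum_k J k w + eta * \sum_k p k w.

Definition doubly_stochastic {R : realType} {N : nat} (A : 'M[R]_N) : Prop :=
  [/\ forall i j, 0 <= A i j, forall i, \sum_j A i j = 1
    & forall j, \sum_i A i j = 1].

Definition primitive_mx {R : realType} {N : nat} (A : 'M[R]_N) : Prop :=
  (forall i j, 0 <= A i j) /\
  exists2 m : nat, (0 < m)%N & forall i j, 0 < (A ^+ m) i j.

Section Probability.
Context {R : realType} {M : nat} {d : measure_display} {T : measurableType d}.
Variable P : probability T R.

(* Measurability of a random vector is expressed coordinatewise, relatively to
   a given sigma-algebra G on T. *)
Definition measurable_wrt (G : set (set T)) (Y : T -> 'rV[R]_M) : Prop :=
  forall (j : 'I_M) (B : set R), measurable B -> G ((fun t => Y t 0 j) @^-1` B).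

Definition random_vector (Y : T -> 'rV[R]_M) : Prop :=
  measurable_wrt measurable Y.

Definition mean_square (Y : T -> 'rV[R]_M) : \bar R :=
  'E_P[(fun t => l2norm (Y t) ^+ 2)%R]%E.

(* Z is a version of E(Y | G). *)
Definition is_cond_expectation (G : set (set T)) (Y Z : T -> 'rV[R]_M) : Prop :=
  measurable_wrt G Z /\ forall j : 'I_M,
    [/\ P.-integrable setT (fun t => (Y t 0 j)%:E),
        P.-integrable setT (fun t => (Z t 0 j)%:E)
      & forall A, G A ->
          (\int[P]_(t in A) (Z t 0 j)%:E = \int[P]_(t in A) (Y t 0 j)%:E)%E].

End Probability.

Section Diffusion.
Context {R : realType} {N M : nat} {d : measure_display} {T : measurableType d}.
Variable P : probability T R.
(* w k i is the iterate of agent k at time i; v k i x is the gradient noise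
   of agent k at time i and at the point x. *)
Variables (w : 'I_N -> nat -> T -> 'rV[R]_M)
  (v : 'I_N -> nat -> 'rV[R]_M -> T -> 'rV[R]_M).

(* The sigma-algebra generated by the iterates up to and including time i. *)
Definition history (i : nat) : set (set T) :=
  <<s [set E | exists k j c (B : set R),
         [/\ (j <= i)%N, measurable B & E = (fun t => w k j t 0 c) @^-1` B]] >>.

(* Only square-integrable Y are considered: otherwise E|Y|^2 is infinite and the conditional expectation need not exist. *)
Definition gradient_noise_model (alpha sigma_v2 : R) : Prop :=
  forall (k : 'I_N) (i : nat) (Y : T -> 'rV[R]_M),
    measurable_wrt (history i) Y -> (mean_square P Y < +oo)%E ->
    let vY t := v k i.+1 (Y t) t in
    [/\ random_vector vY,
        is_cond_expectation P (history i) vY (fun=> 0)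
      & (mean_square P vY <= alpha%:E * mean_square P Y + sigma_v2%:E)%E].

Variables (nbh : 'I_N -> {set 'I_N}) (J p : 'I_N -> 'rV[R]_M -> R)
  (A1 A2 : 'M[R]_N) (mu eta : R).

(* phi k i, zeta k i and psi k i are the intermediate quantities of the step
   from time i to time i.+1. *)
Definition phi (k : 'I_N) (i : nat) (t : T) : 'rV[R]_M :=
  \sum_(l in nbh k) A1 l k *: w l i t.

Definition zeta (k : 'I_N) (i : nat) (t : T) : 'rV[R]_M :=
  phi k i t - mu *: (grad (J k) (phi k i t) + v k i.+1 (phi k i t) t).

Definition psi (k : 'I_N) (i : nat) (t : T) : 'rV[R]_M :=
  zeta k i t - (mu * eta) *: grad (p k) (zeta k i t).

Definition penalized_diffusion : Prop :=
  forall (k : 'I_N) (i : nat) (t : T),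
    w k i.+1 t = \sum_(l in nbh k) A2 l k *: psi l i t.

End Diffusion.

Definition step_size_ok {R : realType} {N : nat} (lmin lmax lpmax : 'I_N -> R)
    (alpha eta mu : R) : Prop :=
  0 < mu /\ forall k,
    mu < Num.min (2 * lmax k / (lmax k ^+ 2 + 2 * alpha))
        (Num.min (2 * lmin k / (lmin k ^+ 2 + 2 * alpha))
                 (2 / (eta * lpmax k))).

(* Main.v *)
Require Import Defs.
From HB Require Import structures.
From mathcomp Require Import all_boot all_order all_algebra.
From mathcomp Require Import all_classical all_reals all_analysis.
From mathcomp Require Import measurable_realfun.
From mathcomp Require Import ring lra.

Import Order.TTheory GRing.Theory Num.Theory.
Import numFieldNormedType.Exports.

Local Open Scope classical_set_scope.
Local Open Scope ring_scope.

(* Fix reference points W_k and let S_i be the sum over k of E|w_(k,i) - W_k|^2.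
   By the mean value theorem applied to <G(.), u>, a gradient step on J_k
   contracts squared distances by q < 1 and a step on eta p_k is nonexpansive;
   mixing by a doubly stochastic matrix does not increase the sum of squared
   norms; and the noise, orthogonal to everything determined by the past, adds
   only mu^2 (2 alpha S_i + O(1)).  Hence S_(i+1) <= beta S_i + c, where c
   contains the noise variance, of order mu^2, and the defect of W, i.e. how far
   the noiseless network map is from fixing W.  With W_k = wo this already gives
   stability.  For the rate take W_k = wo + mu z_k, where z corrects for the
   individual gradients not vanishing at wo: since they sum to zero, and since
   primitivity makes the constants the only vectors fixed by A, z can be chosen
   independently of mu so that the defect is O(mu^2).  As 1 - beta is of order
   mu, S is eventually O(mu). *)

(** * Quadratic forms and Lipschitz bounds *)

Section InnerProduct.
Context {R : realType} {M : nat}.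
Implicit Types (x y z : 'rV[R]_M) (a : R).

Definition sqnorm x : R := dotp x x.

Lemma dotpE x y : dotp x y = \sum_j x 0 j * y 0 j.
Proof. by rewrite /dotp mxE; apply: eq_bigr => j _; rewrite mxE. Qed.

Lemma dotpC x y : dotp x y = dotp y x.
Proof. by rewrite !dotpE; apply: eq_bigr => j _; rewrite mulrC. Qed.

Lemma dotpDl x y z : dotp (x + y) z = dotp x z + dotp y z.
Proof. by rewrite /dotp mulmxDl mxE. Qed.

Lemma dotpZl a x z : dotp (a *: x) z = a * dotp x z.
Proof. by rewrite /dotp -scalemxAl mxE. Qed.

Lemma dotpNl x z : dotp (- x) z = - dotp x z.
Proof. by rewrite /dotp mulNmx mxE. Qed.

Lemma dotpBl x y z : dotp (x - y) z = dotp x z - dotp y z.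
Proof. by rewrite dotpDl dotpNl. Qed.

Lemma dotpDr x y z : dotp x (y + z) = dotp x y + dotp x z.
Proof. by rewrite dotpC dotpDl !(dotpC x). Qed.

Lemma dotpZr a x z : dotp x (a *: z) = a * dotp x z.
Proof. by rewrite dotpC dotpZl (dotpC x). Qed.

Lemma dotpNr x z : dotp x (- z) = - dotp x z.
Proof. by rewrite dotpC dotpNl (dotpC x). Qed.

Lemma dotp_suml (I : Type) (s : seq I) (F : I -> 'rV[R]_M) z :
  dotp (\sum_(i <- s) F i) z = \sum_(i <- s) dotp (F i) z.
Proof. by rewrite /dotp mulmx_suml summxE. Qed.

Lemma sqnorm_ge0 x : 0 <= sqnorm x.
Proof. by rewrite /sqnorm dotpE sumr_ge0// => j _; rewrite -expr2 sqr_ge0. Qed.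

Lemma l2norm_sqr x : l2norm x ^+ 2 = sqnorm x.
Proof. by rewrite /l2norm sqr_sqrtr// sqnorm_ge0. Qed.

Lemma sqnormZ a x : sqnorm (a *: x) = a ^+ 2 * sqnorm x.
Proof. by rewrite /sqnorm dotpZl dotpZr mulrA. Qed.

Lemma sqnormN x : sqnorm (- x) = sqnorm x.
Proof. by rewrite /sqnorm dotpNl dotpNr opprK. Qed.

Lemma sqnormD x y : sqnorm (x + y) = sqnorm x + 2 * dotp x y + sqnorm y.
Proof. by rewrite /sqnorm dotpDl !dotpDr (dotpC y x); ring. Qed.

Lemma sqnormB x y : sqnorm (x - y) = sqnorm x - 2 * dotp x y + sqnorm y.
Proof. by rewrite sqnormD sqnormN dotpNr mulrN. Qed.

Lemma sqnormBC x y : sqnorm (x - y) = sqnorm (y - x).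
Proof. by rewrite -sqnormN opprB. Qed.

(** Young's inequality, from expanding the squared norm of [e *: x - y]. The free weight [e] is
    later tuned against the contraction factor. *)
Lemma sqnormD_young (e : R) x y : 0 < e ->
  sqnorm (x + y) <= (1 + e) * sqnorm x + (1 + e^-1) * sqnorm y.
Proof.
move=> e0; have := sqnorm_ge0 (e *: x - y).
rewrite sqnormB sqnormZ dotpZl sqnormD => h.
suff: 2 * dotp x y <= e * sqnorm x + e^-1 * sqnorm y by lra.
rewrite -(ler_pM2l e0) mulrDr (mulrA e e^-1) mulfV ?gt_eqF// mul1r.
by move: h; rewrite expr2; lra.
Qed.

Lemma sqnormD_le2 x y : sqnorm (x + y) <= 2 * sqnorm x + 2 * sqnorm y.
Proof. by have := sqnormD_young 1 x y ltr01; rewrite invr1; lra. Qed.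

Lemma normr_dotp_le x y : `|2 * dotp x y| <= sqnorm x + sqnorm y.
Proof.
have := sqnorm_ge0 (x - y); have := sqnorm_ge0 (x + y).
by rewrite sqnormD sqnormB ler_norml => ? ?; apply/andP; split; lra.
Qed.

(** The gap between the two sides is the weighted variance of the points [x l] about their mean
    [m]. *)
Lemma sqnorm_convex (N : nat) (c : 'I_N -> R) (x : 'I_N -> 'rV[R]_M) :
  (forall l, 0 <= c l) -> \sum_l c l = 1 ->
  sqnorm (\sum_l c l *: x l) <= \sum_l c l * sqnorm (x l).
Proof.
move=> c0 c1; set m := \sum_l c l *: x l.
have : 0 <= \sum_l c l * sqnorm (x l - m).
  by rewrite sumr_ge0// => l _; rewrite mulr_ge0// sqnorm_ge0.
suff -> : \sum_l c l * sqnorm (x l - m) =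
          \sum_l c l * sqnorm (x l) - sqnorm m by rewrite subr_ge0.
under eq_bigr => l _ do rewrite sqnormB mulrDr mulrBr.
rewrite big_split/= sumrB -mulr_suml c1 mul1r.
have -> : \sum_l c l * (2 * dotp (x l) m) = 2 * sqnorm m.
  transitivity (2 * dotp (\sum_l c l *: x l) m) => //.
  rewrite dotp_suml mulr_sumr.
  by apply: eq_bigr => l _; rewrite dotpZl mulrCA.
by ring.
Qed.

Lemma symmetric_dotp (S : 'M[R]_M) x y : S^T = S ->
  dotp (x *m S) y = dotp x (y *m S).
Proof.
by move=> St; rewrite /dotp trmx_mul St mulmxA.
Qed.

(** For symmetric matrices a bound on the quadratic form is a bound on the spectral norm; this form
    avoids eigenvalues. *)
Definition opnorm_le (g : R) (S : 'M[R]_M) :=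
  S^T = S /\ forall x, `|dotp (x *m S) x| <= g * sqnorm x.

(** Polarization: the forms at [x + y] and [x - y] differ by four times the bilinear term, and the
    parallelogram identity sums their bounds. *)
Lemma opnorm_le_dotp (g : R) (S : 'M[R]_M) x y : opnorm_le g S ->
  2 * dotp (x *m S) y <= g * (sqnorm x + sqnorm y).
Proof.
move=> [St Sg]; have := Sg (x + y); have := Sg (x - y).
rewrite !ler_norml => /andP[h1 _] /andP[_ h2].
move: h1 h2.
rewrite !mulmxDl mulNmx !dotpDl !dotpDr !sqnormD !dotpNl !dotpNr sqnormN.
by rewrite (symmetric_dotp _ y x St) (dotpC y (x *m S)); lra.
Qed.

End InnerProduct.

Section Lipschitz.
Context {R : realType} {M : nat}.
Implicit Types (G : 'rV[R]_M -> 'rV[R]_M) (x y u : 'rV[R]_M).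

Lemma dotp_continuous u : continuous ((dotp ^~ u) : 'rV[R]_M -> R).
Proof.
rewrite (_ : dotp ^~ u = fun z => \sum_j z 0 j * u 0 j); last first.
  by apply/funext => z; rewrite dotpE.
apply: continuous_big => [|j _ z]; first exact: add_continuous.
have h := @coord_continuous R 1 M 0 j z.
by apply: cvgMr_tmp; [exact: nbhs_filter|exact: h].
Qed.

Lemma is_diff_dotp u z : is_diff z ((dotp ^~ u) : 'rV[R]_M -> R) (dotp ^~ u).
Proof.
have lin : linear ((dotp ^~ u) : 'rV[R]_M -> R).
  by move=> a x y; rewrite dotpDl dotpZl.
pose fM := GRing.isLinear.Build _ _ _ _ _ lin.
pose f : {linear _ -> _} := HB.pack (dotp ^~ u) fM.
rewrite (_ : dotp ^~ u = f)//.
apply: DiffDef; first exact/linear_differentiable/dotp_continuous.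
by rewrite diff_lin //; exact: dotp_continuous.
Qed.

Lemma is_diff_line x y (t : R) :
  is_diff t (fun s : R => y + s *: x) ( *:%R ^~ x).
Proof.
have h := @is_diff_scalel R 'rV[R]_M t x.
have := @is_diffD _ _ _ _ _ _ _ t (is_diff_cst y t) h.
by rewrite add0r.
Qed.

Lemma is_derive_dotp_line G x y u (t : R) :
  differentiable G (y + t *: x) ->
  is_derive t (1 : R) (fun s : R => dotp (G (y + s *: x)) u : R)
    (dotp (x *m 'J G (y + t *: x)) u).
Proof.
move=> dG.
have d1 := is_diff_line x y t.
have d2 := @is_diff_comp _ _ _ _ _ _ _ _ t d1 (differentiableP dG).
have d3 := @is_diff_comp _ _ _ _ _ _ _ _ t d2 (is_diff_dotp u _).
have [df dfE] := d3.
apply: DeriveDef; first exact: diff_derivable.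
rewrite deriveE// dfE /= scale1r.
by rewrite /jacobian mul_rV_lin1.
Qed.

(** A vector-valued map has no mean value theorem with equality, so the scalar theorem is applied to
    the pairing with [u] along the segment; the point [z] depends on [u]. *)
Lemma mean_value_dotp G x y u : (forall z, differentiable G z) ->
  exists z, dotp (G x - G y) u = dotp ((x - y) *m 'J G z) u.
Proof.
move=> dG.
have D (t : R) := is_derive_dotp_line G (x - y) y u t (dG _).
have [|c _ hc] := @MVT R _ _ 0 1 ltr01 (fun t _ => D t).
  apply: continuous_subspaceT => t.
  by apply: differentiable_continuous; apply/derivable1_diffP; have [] := D t.
exists (y + c *: (x - y)); rewrite dotpBl.
have -> : dotp (G x) u = dotp (G (y + 1 *: (x - y))) u.
  by rewrite scale1r addrC subrK.
have -> : dotp (G y) u = dotp (G (y + 0 *: (x - y))) u.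
  by rewrite scale0r addr0.
by rewrite hc [1 - 0]subr0 mulr1.
Qed.

(** Pair with [u = G x - G y] and polarize. Scaling [x - y] by [g] balances the two squares and
    gives the sharp constant; dividing by [g] afterwards forces a separate treatment of [g = 0]. *)
Lemma lipschitz_of_jacobian G (g : R) : 0 <= g ->
  (forall z, differentiable G z) -> (forall z, opnorm_le g ('J G z)) ->
  forall x y, sqnorm (G x - G y) <= g ^+ 2 * sqnorm (x - y).
Proof.
move=> g0 dG Jg x y.
have [z zE] := mean_value_dotp G x y (G x - G y) dG.
have [gE|gn0] := eqVneq g 0; last first.
  have gp : 0 < g by rewrite lt_neqAle eq_sym gn0.
  have := opnorm_le_dotp g _ (g *: (x - y)) (G x - G y) (Jg z).
  rewrite -scalemxAl dotpZl -zE sqnormZ -/(sqnorm _) => h.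
  rewrite -(ler_pM2l gp).
  by move: h; rewrite expr2 -mulrA; lra.
have := opnorm_le_dotp g _ (x - y) (G x - G y) (Jg z).
by rewrite -zE -/(sqnorm _) gE expr2; lra.
Qed.

End Lipschitz.

(** * Gradient steps and stationarity of minimizers *)

Section GradientMaps.
Context {R : realType} {M : nat}.
Implicit Types (f : 'rV[R]_M -> R) (x y z : 'rV[R]_M).

Lemma jacobian_grad_step f (c : R) z : twice_differentiable f ->
  'J (fun x => x - c *: grad f x) z = 1%:M - c *: hess f z.
Proof.
move=> [_ /(_ z) dgf].
rewrite (_ : (fun x => x - c *: grad f x) = id - c *: grad f); last first.
  by apply/funext.
have dg : differentiable (id - c *: grad f) z.
  by apply: differentiableB => //; exact: differentiableZ.
apply/row_matrixP => i; rewrite !rowE mulmxBr mulmx1 -scalemxAr.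
have E1 : _ = _ *m hess f z := deriveEjacobian (delta_mx 0 i) dgf.
have E2 := deriveEjacobian (delta_mx 0 i) dg.
apply: etrans (esym E2) _.
have derg : derivable (grad f) z (delta_mx 0 i) by exact: diff_derivable.
have deri : derivable id z (delta_mx 0 i) by exact: derivable_id.
have E3 := deriveB deri (derivableZ (k := c) derg).
apply: etrans E3 _.
have E4 := deriveZ c derg.
rewrite derive_id; congr (_ - _).
apply: etrans E4 _.
by rewrite E1.
Qed.

(** [psd] includes symmetry, so the symmetry of a Hessian is read off from its Loewner bound instead
    of from a theorem on mixed partial derivatives. *)
Lemma psd_scalarB (a : R) (H : 'M[R]_M) : psd (H - a%:M) ->
  H^T = H /\ forall x, a * sqnorm x <= dotp (x *m H) x.
Proof.
move=> [Ht H0]; split=> [|x].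
  by apply: (addIr (- a%:M)); rewrite -{1}(tr_scalar_mx M a) -linearB.
have := H0 x; rewrite mulmxBr mul_mx_scalar dotpBl dotpZl subr_ge0.
by rewrite /sqnorm.
Qed.

Lemma psd_Bscalar (b : R) (H : 'M[R]_M) : psd (b%:M - H) ->
  forall x, dotp (x *m H) x <= b * sqnorm x.
Proof.
move=> [_ H0] x.
have := H0 x; rewrite mulmxBr mul_mx_scalar dotpBl dotpZl subr_ge0.
by rewrite /sqnorm.
Qed.

Lemma lipschitz_grad f (b : R) x y : 0 <= b -> twice_differentiable f ->
  (forall z, loewner_le 0 (hess f z) /\ loewner_le (hess f z) b%:M) ->
  sqnorm (grad f x - grad f y) <= b ^+ 2 * sqnorm (x - y).
Proof.
move=> b0 df H; apply: lipschitz_of_jacobian => // [|z]; first exact: df.2.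
have [] := H z; rewrite -(raddf0 (@scalar_mx R M)) => /psd_scalarB[Ht lo] /psd_Bscalar hi.
split=> // v; rewrite ler_norml hi andbT.
have := lo v; have := sqnorm_ge0 v; nra.
Qed.

(** The Jacobian of the step is [1 - c *: hess f], whose quadratic form lies between [1 - c * b] and
    [1 - c * a] times the squared norm; both factors are at most the square root of [q] in absolute
    value. *)
Lemma lipschitz_grad_step f (a b c q : R) x y : 0 <= c ->
  twice_differentiable f ->
  (forall z, loewner_le a%:M (hess f z) /\ loewner_le (hess f z) b%:M) ->
  (1 - c * a) ^+ 2 <= q -> (1 - c * b) ^+ 2 <= q ->
  sqnorm ((x - c *: grad f x) - (y - c *: grad f y)) <= q * sqnorm (x - y).
Proof.
move=> c0 df H qa qb.
have q0 : 0 <= q by rewrite (le_trans _ qa)// sqr_ge0.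
rewrite -(sqr_sqrtr q0).
pose G v := v - c *: grad f v.
apply: (lipschitz_of_jacobian G) => [|z|z]; first exact: sqrtr_ge0.
  by apply: differentiableB => //; apply: differentiableZ; exact: df.2.
have [/psd_scalarB[Ht lo] /psd_Bscalar hi] := H z.
rewrite jacobian_grad_step//; split=> [|v].
  by rewrite linearB/= tr_scalar_mx linearZ/= Ht.
rewrite mulmxBr mulmx1 -scalemxAr dotpBl dotpZl -/(sqnorm v).
have ha : `|1 - c * a| <= Num.sqrt q by rewrite -sqrtr_sqr ler_sqrt.
have hb : `|1 - c * b| <= Num.sqrt q by rewrite -sqrtr_sqr ler_sqrt.
move: ha hb; rewrite !ler_norml => /andP[_ ha] /andP[hb _].
have v0 := sqnorm_ge0 v.
have l1 := ler_wpM2l c0 (lo v); have l2 := ler_wpM2l c0 (hi v).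
by apply/andP; split; nra.
Qed.

(** Fermat's rule on each coordinate line through [z], at the interior point 0 of the interval from
    -1 to 1. *)
Lemma grad_minimizer f z : (forall y, differentiable f y) ->
  (forall y, f z <= f y) -> grad f z = 0.
Proof.
move=> df zmin; apply/rowP => j; rewrite !mxE.
have d (t : R) := is_diff_comp (is_diff_line (delta_mx 0 j) z t) (differentiableP (df _)).
have [|||t _|_] := @derive1_at_min R (fun s : R => f (z + s *: delta_mx 0 j)) (-1) 1 0.
- lra.
- by move=> t _; apply: diff_derivable; have [] := d t.
- by rewrite in_itv/=; lra.
- by rewrite scale0r addr0.
have [d0 d0E] := d 0.
by rewrite deriveE// d0E/= scale1r scale0r addr0 -deriveE.
Qed.

Lemma grad_glob_cost (N : nat) (J p : 'I_N -> 'rV[R]_M -> R) (eta : R) z :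
  (forall k y, differentiable (J k) y) -> (forall k y, differentiable (p k) y) ->
  (forall y, differentiable (glob_cost J p eta) y) /\
  grad (glob_cost J p eta) z = \sum_k (grad (J k) z + eta *: grad (p k) z).
Proof.
move=> dJ dp.
have -> : glob_cost J p eta = (\sum_k J k) + eta *: (\sum_k p k).
  by apply/funext => y; rewrite /glob_cost !fctE !fct_sumE.
split=> [y|].
  apply: differentiableD; first exact: differentiable_sum.
  by apply: differentiableZ; exact: differentiable_sum.
apply/rowP => j; rewrite summxE !mxE.
have derJ k v : derivable (J k) z v by exact: diff_derivable.
have derp k v : derivable (p k) z v by exact: diff_derivable.
rewrite deriveD; [|exact: derivable_sum|by apply: derivableZ; exact: derivable_sum].
rewrite deriveZ; last exact: derivable_sum.
rewrite !derive_sum// scaler_sumr -big_split/=.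
by apply: eq_bigr => k _; rewrite !mxE.
Qed.

Lemma sum_grad_minimizer (N : nat) (J p : 'I_N -> 'rV[R]_M -> R) (eta : R) z :
  (forall k y, differentiable (J k) y) -> (forall k y, differentiable (p k) y) ->
  unique_minimizer (glob_cost J p eta) z ->
  \sum_k (grad (J k) z + eta *: grad (p k) z) = 0.
Proof.
move=> dJ dp zmin.
have [dg <-] := grad_glob_cost N J p eta z dJ dp.
apply: grad_minimizer => // y.
by have [->//|/zmin/ltW] := eqVneq y z.
Qed.

End GradientMaps.

(** * Doubly stochastic mixing *)

Section Mixing.
Context {R : realType} {N M : nat}.
Implicit Types (A : 'M[R]_N) (x z b : 'I_N -> 'rV[R]_M).

Lemma doubly_stochastic1 : doubly_stochastic (1%:M : 'M[R]_N).
Proof.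
split=> [i j|i|j]; first by rewrite mxE ler0n.
  rewrite (bigD1 i)//= big1 ?addr0 ?mxE ?eqxx// => j ji.
  by rewrite mxE eq_sym (negbTE ji).
by rewrite (bigD1 j)//= big1 ?addr0 ?mxE ?eqxx// => i ij; rewrite mxE (negbTE ij).
Qed.

(** Unit column sums make each mixture convex; after exchanging the sums, unit row sums give every
    agent total weight one. *)
Lemma sum_sqnorm_mix A x : doubly_stochastic A ->
  \sum_k sqnorm (\sum_l A l k *: x l) <= \sum_l sqnorm (x l).
Proof.
move=> [A0 Ar Ac].
apply: (@le_trans _ _ (\sum_k \sum_l A l k * sqnorm (x l))).
  by apply: ler_sum => k _; exact: sqnorm_convex.
rewrite exchange_big/=.
by under eq_bigr => l _ do rewrite -mulr_suml Ar mul1r.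
Qed.

Lemma sum_mix A x : doubly_stochastic A ->
  \sum_k \sum_l A l k *: x l = \sum_l x l.
Proof.
move=> [_ Ar _]; rewrite exchange_big/=.
by under eq_bigr => l _ do rewrite -scaler_suml Ar scale1r.
Qed.

Lemma mix_const A (w : 'rV[R]_M) k : doubly_stochastic A ->
  \sum_l A l k *: w = w.
Proof. by move=> [_ _ Ac]; rewrite -scaler_suml Ac scale1r. Qed.

Lemma mix1 x k : \sum_l (1%:M : 'M[R]_N) l k *: x l = x k.
Proof.
rewrite (bigD1 k)//= big1 ?addr0 ?mxE ?eqxx ?scale1r// => l lk.
by rewrite mxE (negbTE lk) scale0r.
Qed.

(** Maximum principle: [c] is also fixed by a positive power of [A]. At an index where [c] is
    maximal its value is an average with positive weights of all entries, so every entry equals the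
    maximum. *)
Lemma primitive_fixed_const A (c : 'cV[R]_N) : primitive_mx A ->
  doubly_stochastic A -> A *m c = c -> forall i j, c i 0 = c j 0.
Proof.
move=> [A0 [m _ Am0]] [_ Ar _] Ac i0.
have Amc : A ^+ m *m c = c.
  elim: m {Am0} => [|m ih]; first by rewrite expr0 mul1mx.
  by rewrite exprS -mulmxA ih.
have Am1 : A ^+ m *m const_mx 1 = const_mx 1 :> 'cV[R]_N.
  elim: m {Am0 Amc} => [|m ih]; first by rewrite expr0 mul1mx.
  rewrite exprS -mulmxA ih; apply/colP => i; rewrite !mxE.
  by rewrite -[RHS](Ar i); apply: eq_bigr => j _; rewrite mxE mulr1.
case: (@arg_maxP _ _ _ i0 xpredT (fun i => c i 0) isT) => i _ imax.
suff ci j : c j 0 = c i 0 by move=> j; rewrite !ci.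
have h : \sum_j (A ^+ m) i j * (c i 0 - c j 0) = 0.
  under eq_bigr => l _ do rewrite mulrBr.
  rewrite sumrB -mulr_suml.
  have -> : \sum_l (A ^+ m) i l = 1.
    move/colP: Am1 => /(_ i); rewrite !mxE => <-.
    by apply: eq_bigr => l _; rewrite mxE mulr1.
  by move/colP: Amc => /(_ i); rewrite mxE => ->; rewrite mul1r subrr.
have h0 l : true -> 0 <= (A ^+ m) i l * (c i 0 - c l 0).
  by move=> _; apply: mulr_ge0; [exact: ltW|rewrite subr_ge0; exact: imax].
have /eqP : (A ^+ m) i j * (c i 0 - c j 0) = 0 by exact: (psumr_eq0P h0 h).
rewrite mulf_eq0 gt_eqF//= subr_eq0 => /eqP->.
by [].
Qed.

(** Fredholm alternative: the rows of [B] lie in the row space of [1 - A] once [B] annihilates its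
    cokernel [K]. The columns of [K] are fixed by [A], hence constant, so pairing [b] with them
    gives a multiple of the sum of [b], which vanishes. *)
Lemma exists_mix_correction A b : primitive_mx A -> doubly_stochastic A ->
  \sum_k b k = 0 -> exists z, forall k, z k = \sum_l A l k *: z l + b k.
Proof.
move=> Ap Ads b0.
pose B : 'M[R]_(M, N) := \matrix_(j, k) b k 0 j.
have /submxP[D BD] : (B <= 1%:M - A)%MS.
  rewrite submxE; apply/eqP; set K := cokermx _.
  have KA : A *m K = K.
    have := mulmx_coker (1%:M - A); rewrite mulmxBl mul1mx => /eqP.
    by rewrite subr_eq0 => /eqP <-.
  have Kc l l' j : K l j = K l' j.
    have cK : A *m col j K = col j K by rewrite colE mulmxA KA.
    by have := primitive_fixed_const A _ Ap Ads cK l l'; rewrite !mxE.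
  apply/matrixP => i j; rewrite !mxE.
  (* An index is needed to name the common value of a column of [K]; for [N = 0] the sum is
     empty. *)
  have [l0 _|N0] := pickP 'I_N; last by rewrite big1// => l; have := N0 l.
  transitivity ((\sum_l b l) 0 i * K l0 j); last by rewrite b0 !mxE mul0r.
  rewrite summxE mulr_suml; apply: eq_bigr => l _.
  by rewrite mxE (Kc l l0).
exists (fun k => \row_j D j k) => k; apply/rowP => j.
move/matrixP : BD => /(_ j k); rewrite mulmxBr mulmx1 !mxE summxE => ->.
rewrite -[LHS](subrK (\sum_l D j l * A l k)) addrC; congr (_ + _).
by apply: eq_bigr => l _; rewrite !mxE mulrC.
Qed.

(* To first order in mu, the noiseless network map fixes wo + mu z iff z solves
   this equation, with b l the gradient of agent l's penalized cost at wo. *)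
Lemma exists_network_correction A A1 A2 b : primitive_mx A ->
  doubly_stochastic A -> (A1, A2) = (1%:M, A) \/ (A1, A2) = (A, 1%:M) ->
  \sum_k b k = 0 ->
  exists z, forall k, z k = \sum_l A2 l k *: (\sum_m A1 m l *: z m - b l).
Proof.
move=> Ap Ads A12 b0; case: A12 => -[-> ->].
  (* When combination comes last the gradients are mixed as well; mixing preserves their zero
     sum. *)
  have [|z zE] := exists_mix_correction A (fun k => - \sum_l A l k *: b l) Ap Ads.
    by rewrite sumrN sum_mix// b0 oppr0.
  exists z => k; rewrite {1}zE -sumrB; apply: eq_bigr => l _.
  by rewrite mix1 scalerBr.
have [|z zE] := exists_mix_correction A (fun k => - b k) Ap Ads.
  by rewrite sumrN b0 oppr0.
by exists z => k; rewrite mix1 -zE.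
Qed.

End Mixing.

(** * Scalar recursions and upper limits *)

Lemma affine_recursion_bound {R : realType} (S : nat -> R) (beta c : R) :
  0 <= beta -> beta < 1 -> (forall n, S n.+1 <= beta * S n + c) ->
  forall e, 0 < e -> \forall n \near \oo, S n <= c / (1 - beta) + e.
Proof.
move=> b0 b1 Srec e e0; set D := c / (1 - beta).
have b1n : 1 - beta != 0 by rewrite gt_eqF// subr_gt0.
(* [D] is the fixed point of the affine map; the excess of [S] over it is dominated by a geometric
   sequence. *)
have DE : beta * D + c = D.
  by rewrite /D; field.
have Sn n : S n <= D + geometric (S 0%N - D) beta n.
  elim: n => [|n ih]; first by rewrite /= expr0 mulr1 subrKC.
  apply: (le_trans (Srec n)).
  apply: (@le_trans _ _ (beta * (D + geometric (S 0%N - D) beta n) + c)).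
    by rewrite lerD2r ler_wpM2l.
  by rewrite /= exprS mulrDr -addrA (addrC _ c) addrA DE mulrCA.
have cv : geometric (S 0%N - D) beta @ \oo --> (0 : R).
  by apply: cvg_geometric; rewrite ger0_norm.
near=> n; apply: (le_trans (Sn n)); rewrite lerD2l.
apply: (le_trans (ler_norm _)).
near: n; move/cvgrPdist_le : cv => /(_ e e0); apply: filterS => n.
by rewrite sub0r normrN.
Unshelve. all: by end_near. Qed.

Lemma limn_esup_le_near {R : realType} (u : nat -> \bar R) (x : \bar R) :
  (\forall n \near \oo, (u n <= x)%E) -> (limn_esup u <= x)%E.
Proof.
move=> ux; rewrite /limn_esup limf_esupE.
apply: ereal_inf_le; exists (ereal_sup (u @` [set n | (u n <= x)%E])).
  by exists [set n | (u n <= x)%E].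
by apply: ge_ereal_sup => _ [n un <-].
Qed.

(** * Square-integrable random vectors and conditional orthogonality *)

Section RandomVectors.
Context {R : realType} {M : nat} {d : measure_display} {T : measurableType d}.
Implicit Types (Y Z : T -> 'rV[R]_M).

Lemma random_vectorP Y :
  random_vector Y <-> forall j, measurable_fun setT (fun t => Y t 0 j).
Proof.
split=> [mY j _ B mB|mY j B mB]; first by rewrite setTI; exact: mY.
by rewrite -[X in measurable X]setTI; exact: mY.
Qed.

Lemma random_vector_sum (I : Type) (s : seq I) (F : I -> T -> 'rV[R]_M) :
  (forall i, random_vector (F i)) -> random_vector (fun t => \sum_(i <- s) F i t).
Proof.
move=> mF; apply/random_vectorP => j.
rewrite (_ : (fun _ => _) = fun t => \sum_(i <- s) F i t 0 j); last first.
  by apply/funext => t; rewrite summxE.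
by apply: measurable_sum => i; have /random_vectorP := mF i; exact.
Qed.

Lemma random_vectorZ (a : R) Y :
  random_vector Y -> random_vector (fun t => a *: Y t).
Proof.
move=> /random_vectorP mY; apply/random_vectorP => j.
rewrite (_ : (fun _ => _) = fun t => a * Y t 0 j); last first.
  by apply/funext => t; rewrite mxE.
by apply: measurable_funM => //; exact: measurable_cst.
Qed.

Lemma random_vectorD Y Z :
  random_vector Y -> random_vector Z -> random_vector (fun t => Y t + Z t).
Proof.
move=> /random_vectorP mY /random_vectorP mZ; apply/random_vectorP => j.
rewrite (_ : (fun _ => _) = fun t => Y t 0 j + Z t 0 j); last first.
  by apply/funext => t; rewrite mxE.
exact: measurable_funD.
Qed.

Lemma random_vectorB Y Z :
  random_vector Y -> random_vector Z -> random_vector (fun t => Y t - Z t).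
Proof.
move=> mY mZ; have := random_vectorD _ _ mY (random_vectorZ (-1) _ mZ).
by under [X in random_vector X -> _]eq_fun do rewrite scaleN1r.
Qed.

Lemma random_vector_cst (x : 'rV[R]_M) : random_vector (fun _ : T => x).
Proof. by apply/random_vectorP => j; exact: measurable_cst. Qed.

(* f o Y is the pointwise limit of f o Y_n, where Y_n, obtained by rounding
   the coordinates of Y to multiples of 1/n, has countably many values. *)
Lemma measurable_continuous_comp (f : 'rV[R]_M -> R) Y :
  continuous f -> random_vector Y -> measurable_fun setT (f \o Y).
Proof.
move=> cf mY.
pose q (n : nat) (z : 'rV[int]_M) : 'rV[R]_M := \row_j ((z 0 j)%:~R / n.+1%:R).
pose Z n t : 'rV[int]_M := \row_j Num.floor (n.+1%:R * Y t 0 j).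
apply: (@measurable_fun_cvg _ _ _ setT (fun n t => f (q n (Z n t)))) => [n _ B mB|t _].
  rewrite setTI.
  (* Split by the value [z] of the integer vector [Z n t]: there are countably many, and each is
     attained on a finite intersection of preimages of half-open intervals. *)
  rewrite (_ : _ @^-1` B = \bigcup_z
      (if f (q n z) \in B then \bigcap_j [set t | Z n t 0 j = z 0 j] else set0)).
    apply: countable_bigcupT_measurable => [|z]; first exact: countableP.
    case: ifP => // _; apply: fin_bigcap_measurable => // j _.
    rewrite (_ : [set t | _] = (fun t => Y t 0 j) @^-1`
       `[(z 0 j)%:~R / n.+1%:R, ((z 0 j) + 1)%:~R / n.+1%:R[%classic).
      by apply: mY; exact: measurable_itv.
    have n0 : (0 : R) < n.+1%:R by rewrite ltr0n.
    apply/seteqP; split=> t /=; rewrite mxE in_itv/= ler_pdivrMr// ltr_pdivlMr//.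
      by rewrite mulrC => <-; exact: floor_itv.
    by rewrite mulrC; exact: floor_def.
  apply/seteqP; split=> [t /= Bt|t [z _]].
    by exists (Z n t) => //; rewrite ifT ?inE.
  case: ifPn => // /[!inE] Bz Zz /=.
  suff -> : Z n t = z by [].
  by apply/rowP => j; exact: Zz.
(* Rounding down moves each coordinate by at most [1 / (n + 1)]. *)
have qY : q n (Z n t) @[n --> \oo] --> Y t.
  apply/cvg_ballP => e e0; near=> n; split=> // i j.
  rewrite ord1 !mxE /ball/=.
  have n0 : (0 : R) < n.+1%:R by rewrite ltr0n.
  have ne : n.+1%:R^-1 < e.
    rewrite invf_plt ?posrE//; apply: (@lt_le_trans _ _ n%:R); last by rewrite ler_nat.
    by near: n; exact: nbhs_infty_gtr.
  have /andP[l u] := floor_itv (n.+1%:R * Y t 0 j).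
  apply: (le_lt_trans _ ne).
  rewrite -(ler_pM2l n0) -{1}(gtr0_norm n0) -normrM mulfV ?gt_eqF//.
  rewrite mulrBr mulrCA mulfV ?gt_eqF// mulr1 ger0_norm ?subr_ge0//.
  by move: u; rewrite intrD; lra.
by apply: cvg_comp; [exact: qY|exact: cf].
Unshelve. all: by end_near. Qed.

Lemma random_vector_continuous_comp (G : 'rV[R]_M -> 'rV[R]_M) Y :
  continuous G -> random_vector Y -> random_vector (G \o Y).
Proof.
move=> cG mY; apply/random_vectorP => j.
apply: (measurable_continuous_comp (fun x => G x 0 j)) => // x.
apply: (@cvg_comp _ _ _ G (fun y => y 0 j)); first exact: cG.
exact: coord_continuous.
Qed.

Lemma measurable_dotp Y Z : random_vector Y -> random_vector Z ->
  measurable_fun setT (fun t => dotp (Y t) (Z t)).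
Proof.
move=> /random_vectorP mY /random_vectorP mZ.
under eq_fun do rewrite dotpE.
by apply: measurable_sum => j; exact: measurable_funM.
Qed.

End RandomVectors.

(** * Products with a variable of zero conditional mean *)

Section Orthogonality.
Context {R : realType} {d : measure_display} {T : measurableType d}.
Variables (P : probability T R) (gen : set (set T)).
Hypothesis gen_measurable : <<s gen >> `<=` measurable.
(** [T] with the coarser sigma-algebra generated by [gen]; measurability on [T'] means being
    determined by the past. *)
Let T' := g_sigma_algebraType gen.
Variable v : T -> R.
Hypothesis v_int : P.-integrable setT (EFin \o v).
Hypothesis v0 : forall A, <<s gen >> A -> (\int[P]_(t in A) (v t)%:E = 0)%E.

Lemma measurable_fun_sub (X : T -> R) :
  measurable_fun (setT : set T') (X : T' -> R) -> measurable_fun (setT : set T) X.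
Proof. by move=> mX _ B mB; apply: gen_measurable; exact: mX. Qed.

Import HBNNSimple.

(** The product is a finite combination of restrictions of [v] to level sets of [s], which belong to
    the coarse sigma-algebra, where [v] integrates to 0. *)
Lemma integral_nnsfun_mul0 (s : {nnsfun T' >-> R}) :
  (\int[P]_t (s t * v t)%:E = 0)%E.
Proof.
have sE (t : T) : ((s t * v t)%:E = \sum_(y <- finmap.enum_fset (fset_set (range s)))
    y%:E * ((EFin \o v) \_ (s @^-1` [set y])) t)%E.
  rewrite fimfunE fsbig_finite//= mulr_suml -sumEFin; apply: eq_bigr => y _.
  rewrite patchE indicE; case: ifP => _; first by rewrite mulr1 EFinM.
  by rewrite mulr0 mul0r mule0.
have ms (y : R) : <<s gen >> (s @^-1` [set y]).
  have : measurable (s @^-1` [set y]) by exact: measurable_funPTI.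
  by [].
have iv y : P.-integrable setT ((EFin \o v) \_ (s @^-1` [set y])).
  apply/(integrable_mkcond _ (gen_measurable _ (ms y))).
  by apply: integrableS v_int => //; exact: (gen_measurable _ (ms y)).
under eq_integral do rewrite sE.
rewrite integral_sum//=; last by move=> y; exact: integrableZl.
rewrite big1// => y _.
by rewrite integralZl// -integral_mkcond v0 ?mule0.
Qed.

(** Approximate [X] from below by simple functions measurable on [T']; the products are dominated by
    the integrable [X v] in absolute value, so dominated convergence applies. *)
Lemma integral_ge0_mul0 (X : T -> R) : (forall t, 0 <= X t) ->
  measurable_fun (setT : set T') (X : T' -> R) ->
  P.-integrable setT (fun t => (X t * v t)%:E) ->
  (\int[P]_t (X t * v t)%:E = 0)%E.
Proof.
move=> X0 mX Xv.
have mX' : measurable_fun (setT : set T') (EFin \o X : T' -> \bar R).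
  exact/measurable_EFinP.
pose s := nnsfun_approx (@measurableT _ T') mX'.
have sX (t : T) : (s n t) @[n --> \oo] --> X t.
  have := @cvg_nnsfun_approx _ T' R setT (@measurableT _ T') _ mX' (fun t _ => X0 t) t I.
  by move/fine_cvgP => [_].
have s_le n (t : T) : s n t <= X t.
  rewrite -(cvg_lim (@Rhausdorff R) (sX t)).
  apply: nondecreasing_cvgn_le; last exact: cvgP (sX t).
  move=> a b ab; have := @nd_nnsfun_approx _ T' R setT (@measurableT _ T') _ mX' a b ab.
  by move/lefP.
have mv : measurable_fun setT v by exact/measurable_EFinP/(measurable_int P).
have [] := @dominated_convergence _ _ _ P setT measurableT
  (fun n t => (s n t * v t)%:E) (fun t => (X t * v t)%:E)
  (fun t => `|(X t * v t)%:E|)%E.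
- move=> n; apply/measurable_EFinP; apply: measurable_funM => //.
  exact: (measurable_fun_sub (s n)).
- exact: measurable_int Xv.
- apply: aeW => t _; apply: cvg_EFin; first exact: nearW.
  by apply: cvgMr_tmp; exact: sX.
- exact: integrable_abse.
- apply: aeW => t n _.
  rewrite /= lee_fin !normrM ler_wpM2r// ger0_norm ?fun_ge0// (le_trans (s_le n t))//.
  exact: ler_norm.
move=> _ _ cv.
rewrite -(cvg_lim _ cv)//.
under eq_fun do rewrite integral_nnsfun_mul0.
by rewrite lim_cst.
Qed.

(** Split [X] into positive and negative parts; each product with [v] is dominated by [X v], hence
    integrable. *)
Lemma integral_mul0 (X : T -> R) :
  measurable_fun (setT : set T') (X : T' -> R) ->
  P.-integrable setT (fun t => (X t * v t)%:E) ->
  (\int[P]_t (X t * v t)%:E = 0)%E.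
Proof.
move=> mX Xv.
have mXp : measurable_fun (setT : set T') (X^\+ : T' -> R) by exact: measurable_funrpos.
have mXn : measurable_fun (setT : set T') (X^\- : T' -> R) by exact: measurable_funrneg.
have mv : measurable_fun setT v by exact/measurable_EFinP/(measurable_int P).
have ip : P.-integrable setT (fun t => (X^\+ t * v t)%:E).
  apply: le_integrable Xv => //.
    by apply/measurable_EFinP; apply: measurable_funM => //; exact: measurable_fun_sub.
  move=> t _ /=; rewrite lee_fin !normrM ler_wpM2r// ger0_norm ?funrpos_ge0//.
  by rewrite /funrpos ge_max normr_ge0 ler_norm.
have im : P.-integrable setT (fun t => (X^\- t * v t)%:E).
  apply: le_integrable Xv => //.
    by apply/measurable_EFinP; apply: measurable_funM => //; exact: measurable_fun_sub.
  move=> t _ /=; rewrite lee_fin !normrM ler_wpM2r// ger0_norm ?funrneg_ge0//.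
  by rewrite /funrneg ge_max normr_ge0 -normrN ler_norm.
under eq_integral => t _.
  rewrite (_ : (X t * v t)%:E = (X^\+ t * v t)%:E - (X^\- t * v t)%:E)%E; last first.
    by rewrite -EFinB -mulrBl -[in LHS](funrposBneg X).
  over.
by rewrite integralB// !integral_ge0_mul0 ?sube0.
Qed.

End Orthogonality.

(** * Calculus of second moments *)

Section SquareIntegrable.
Context {R : realType} {M : nat} {d : measure_display} {T : measurableType d}.
Variable P : probability T R.
Implicit Types (Y Z : T -> 'rV[R]_M) (f g : T -> R).

Definition sqint Y : Prop :=
  random_vector Y /\ P.-integrable setT (EFin \o (fun t => sqnorm (Y t))).

(** A real-valued substitute for [mean_square], so that estimates stay in [R]; it represents the
    second moment when [sqint Y] holds. *)
Definition Esq Y : R := Rintegral P setT (fun t => sqnorm (Y t)).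

Lemma measurable_sqnorm Y : random_vector Y ->
  measurable_fun setT (fun t => sqnorm (Y t)).
Proof. by move=> mY; exact: measurable_dotp. Qed.

Lemma ge0_le_integrable f g : measurable_fun setT f -> (forall t, 0 <= f t) ->
  (forall t, f t <= g t) -> P.-integrable setT (EFin \o g) ->
  P.-integrable setT (EFin \o f).
Proof.
move=> mf f0 fg; apply: le_integrable => //; first exact/measurable_EFinP.
move=> t _ /=; rewrite lee_fin ger0_norm// (le_trans (fg t))//.
exact: ler_norm.
Qed.

Lemma integrable_lin (a b : R) f g : P.-integrable setT (EFin \o f) ->
  P.-integrable setT (EFin \o g) ->
  P.-integrable setT (EFin \o (fun t => a * f t + b * g t)).
Proof.
move=> If Ig; rewrite (_ : EFin \o _ = (fun t => a%:E * (EFin \o f) t)%E \+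
  (fun t => b%:E * (EFin \o g) t)%E)//.
by apply: integrableD => //; exact: integrableZl.
Qed.

Lemma integrable_const (a : R) : P.-integrable setT (EFin \o (fun _ : T => a)).
Proof. exact: finite_measure_integrable_cst. Qed.

Lemma Rintegral_lin (a b : R) f g : P.-integrable setT (EFin \o f) ->
  P.-integrable setT (EFin \o g) ->
  Rintegral P setT (fun t => a * f t + b * g t) =
  a * Rintegral P setT f + b * Rintegral P setT g.
Proof.
move=> If Ig; have Z c h : P.-integrable setT (EFin \o h) ->
    P.-integrable setT (EFin \o (fun t => c * h t)).
  rewrite [X in _ -> P.-integrable _ X](_ : _ =
    fun t => (c%:E * (EFin \o h) t)%E)//.
  exact: integrableZl.
rewrite RintegralD//; [|exact: Z|exact: Z].
by rewrite !RintegralZl.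
Qed.

Lemma Rintegral_const (a : R) : Rintegral P setT (fun=> a) = a.
Proof.
transitivity (a * fine (P setT)); first exact: Rintegral_cst.
by rewrite probability_setT mulr1.
Qed.

Lemma integrable_rsum (I : Type) (s : seq I) (F : I -> T -> R) :
  (forall i, P.-integrable setT (EFin \o F i)) ->
  P.-integrable setT (EFin \o (fun t => \sum_(i <- s) F i t)).
Proof.
move=> IF; rewrite (_ : EFin \o _ = (fun t => \sum_(i <- s) (EFin \o F i) t)%E).
  by apply: integrable_sum => // i _; exact: IF.
by apply/funext => t; rewrite /= sumEFin.
Qed.

Lemma Rintegral_sum (I : Type) (s : seq I) (F : I -> T -> R) :
  (forall i, P.-integrable setT (EFin \o F i)) ->
  Rintegral P setT (fun t => \sum_(i <- s) F i t) =
  \sum_(i <- s) Rintegral P setT (F i).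
Proof.
move=> IF; elim: s => [|i s ih].
  by under eq_Rintegral do rewrite big_nil; rewrite Rintegral_const big_nil.
under eq_Rintegral do rewrite big_cons.
by rewrite RintegralD// ?big_cons ?ih//; exact: integrable_rsum.
Qed.

Lemma sqint_le Y (g : T -> R) : random_vector Y ->
  P.-integrable setT (EFin \o g) -> (forall t, sqnorm (Y t) <= g t) -> sqint Y.
Proof.
move=> mY Ig Yg; split=> //; apply: ge0_le_integrable Ig => //.
  exact: measurable_sqnorm.
by move=> t; exact: sqnorm_ge0.
Qed.

Lemma sqint_cst (x : 'rV[R]_M) : sqint (fun=> x).
Proof. by split; [exact: random_vector_cst|exact: integrable_const]. Qed.

Lemma sqintD Y Z : sqint Y -> sqint Z -> sqint (fun t => Y t + Z t).
Proof.
move=> [mY iY] [mZ iZ]; apply: sqint_le; first exact: random_vectorD.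
  exact: (integrable_lin 2 2 _ _ iY iZ).
by move=> t; exact: sqnormD_le2.
Qed.

Lemma sqintZ (a : R) Y : sqint Y -> sqint (fun t => a *: Y t).
Proof.
move=> [mY iY]; apply: sqint_le; first exact: random_vectorZ.
  exact: (integrable_lin (a ^+ 2) 0 _ _ iY iY).
by move=> t /=; rewrite sqnormZ mul0r addr0.
Qed.

Lemma sqintB Y Z : sqint Y -> sqint Z -> sqint (fun t => Y t - Z t).
Proof.
move=> iY iZ; have := sqintD _ _ iY (sqintZ (-1) _ iZ).
by under [X in sqint X -> _]eq_fun do rewrite scaleN1r.
Qed.

Lemma sqint_sum (I : Type) (s : seq I) (F : I -> T -> 'rV[R]_M) :
  (forall i, sqint (F i)) -> sqint (fun t => \sum_(i <- s) F i t).
Proof.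
move=> iF; elim: s => [|i s ih].
  by under eq_fun do rewrite big_nil; exact: sqint_cst.
by under eq_fun do rewrite big_cons; exact: sqintD.
Qed.

(** Comparison with [G 0] gives linear growth, and constants are integrable under a probability. *)
Lemma sqint_lipschitz (G : 'rV[R]_M -> 'rV[R]_M) (q : R) Y : continuous G ->
  (forall x y, sqnorm (G x - G y) <= q * sqnorm (x - y)) ->
  sqint Y -> sqint (G \o Y).
Proof.
move=> cG lG [mY iY]; apply: sqint_le; first exact: random_vector_continuous_comp.
  exact: (integrable_lin (2 * q) (2 * sqnorm (G 0)) _ _ iY (integrable_const 1)).
move=> t /=; rewrite -{1}(subrK (G 0) (G (Y t))).
apply: (le_trans (sqnormD_le2 _ _)).
have := lG (Y t) 0; rewrite subr0; lra.
Qed.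

Lemma mean_squareE Y : sqint Y -> mean_square P Y = (Esq Y)%:E.
Proof.
move=> [mY iY]; rewrite /mean_square /Esq /Rintegral unlock.
have -> : (fun t => (l2norm (Y t) ^+ 2)%:E) = (fun t => (sqnorm (Y t))%:E).
  by apply/funext => t; rewrite l2norm_sqr.
by rewrite fineK//; exact: integrable_fin_num.
Qed.

Lemma sqintP Y : random_vector Y -> (mean_square P Y < +oo)%E -> sqint Y.
Proof.
move=> mY Yoo; split=> //; apply/integrableP; split.
  by apply/measurable_EFinP; exact: measurable_sqnorm.
move: Yoo; rewrite /mean_square unlock; apply: le_lt_trans.
rewrite le_eqVlt; apply/orP; left; apply/eqP; apply: eq_integral => t _ /=.
by rewrite l2norm_sqr ger0_norm// sqnorm_ge0.
Qed.

Lemma Esq_le Y g : sqint Y -> P.-integrable setT (EFin \o g) ->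
  (forall t, sqnorm (Y t) <= g t) -> Esq Y <= Rintegral P setT g.
Proof. by move=> [mY iY] Ig Yg; apply: le_Rintegral. Qed.

Lemma Esq_ge0 Y : 0 <= Esq Y.
Proof. by apply: Rintegral_ge0 => t _; exact: sqnorm_ge0. Qed.

Lemma sqint_dotp Y Z : sqint Y -> sqint Z ->
  P.-integrable setT (EFin \o (fun t => dotp (Y t) (Z t))).
Proof.
move=> [mY iY] [mZ iZ].
apply: (le_integrable measurableT _ _ (integrable_lin 1 1 _ _ iY iZ)).
  by apply/measurable_EFinP; exact: measurable_dotp.
move=> t _ /=; rewrite lee_fin !mul1r.
apply: (@le_trans _ _ (sqnorm (Y t) + sqnorm (Z t))); last exact: ler_norm.
have := normr_dotp_le (Y t) (Z t); rewrite normrM ger0_norm//.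
have := normr_ge0 (dotp (Y t) (Z t)); lra.
Qed.

Lemma sqint_coord Y (j : 'I_M) : sqint Y ->
  P.-integrable setT (EFin \o (fun t => Y t 0 j ^+ 2)).
Proof.
move=> [mY iY]; apply: ge0_le_integrable iY.
- by apply: measurable_funX; have /random_vectorP := mY; exact.
- by move=> t; exact: sqr_ge0.
- move=> t; rewrite /sqnorm dotpE (bigD1 j)//= -expr2 lerDl.
  by rewrite sumr_ge0// => i _; rewrite -expr2 sqr_ge0.
Qed.

(** Pythagoras: the cross term vanishes coordinate by coordinate, because [X] is determined by the
    past and [V] has zero conditional mean. *)
Lemma Esq_orthogonal (gen : set (set T)) X V (mu : R) :
  <<s gen >> `<=` measurable ->
  measurable_wrt <<s gen >> X -> sqint X -> sqint V ->
  is_cond_expectation P <<s gen >> V (fun=> 0) ->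
  Esq (fun t => X t - mu *: V t) = Esq X + mu ^+ 2 * Esq V.
Proof.
move=> gm mX iX iV [_ condV].
have dXV := sqint_dotp _ _ iX iV.
have ij j : P.-integrable setT (fun t => (X t 0 j * V t 0 j)%:E).
  have := integrable_lin 1 1 _ _ (sqint_coord _ j iX) (sqint_coord _ j iV).
  apply: le_integrable => //.
    apply/measurable_EFinP; apply: measurable_funM.
      by have /random_vectorP := iX.1; exact.
    by have /random_vectorP := iV.1; exact.
  move=> t _ /=; rewrite lee_fin !mul1r normrM.
  rewrite [leRHS]ger0_norm ?addr_ge0 ?sqr_ge0//.
  rewrite -[X in _ <= X + _]real_normK ?num_real//.
  rewrite -[X in _ <= _ + X]real_normK ?num_real//.
  have := normr_ge0 (X t 0 j); have := normr_ge0 (V t 0 j).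
  set a := `|_|; set b := `|_|; nra.
have XV0 : Rintegral P setT (fun t => dotp (X t) (V t)) = 0.
  under eq_Rintegral do rewrite dotpE.
  rewrite Rintegral_sum// big1// => j _.
  have [Vi _ VA] := condV j.
  rewrite /Rintegral (integral_mul0 P gen gm)//.
    move=> A GA; rewrite -VA// mxE integral_cst ?mul0e//.
    exact: gm.
  by move=> _ B mB; rewrite setTI; exact: mX.
rewrite /Esq.
under eq_Rintegral do rewrite sqnormB dotpZr sqnormZ.
transitivity (Rintegral P setT (fun t =>
    1 * (1 * sqnorm (X t) + (- 2 * mu) * dotp (X t) (V t))
    + mu ^+ 2 * sqnorm (V t))).
  by apply: eq_Rintegral => t _; ring.
rewrite Rintegral_lin; [|exact: integrable_lin iX.2 dXV|exact: iV.2].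
rewrite Rintegral_lin; [|exact: iX.2|exact: dXV].
by rewrite XV0; ring.
Qed.

End SquareIntegrable.

(** * The mean-square recursion *)

Section OneStep.
Context {R : realType} {N M : nat} {d : measure_display} {T : measurableType d}.
Variable P : probability T R.
Variables (w : 'I_N -> nat -> T -> 'rV[R]_M)
  (v : 'I_N -> nat -> 'rV[R]_M -> T -> 'rV[R]_M)
  (nbh : 'I_N -> {set 'I_N}) (J p : 'I_N -> 'rV[R]_M -> R)
  (A1 A2 : 'M[R]_N) (mu eta alpha sigma_v2 q : R).
Hypotheses (A1_ds : doubly_stochastic A1) (A2_ds : doubly_stochastic A2)
  (A1_nbh : forall l k, l \notin nbh k -> A1 l k = 0)
  (A2_nbh : forall l k, l \notin nbh k -> A2 l k = 0).
Hypotheses (alpha_ge0 : 0 <= alpha) (q_ge0 : 0 <= q).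
Hypothesis cont_gradJ : forall k, continuous (grad (J k)).
Hypothesis cont_gradp : forall k, continuous (grad (p k)).
Hypothesis lipJ : forall k (x y : 'rV[R]_M), sqnorm ((x - mu *: grad (J k) x) -
  (y - mu *: grad (J k) y)) <= q * sqnorm (x - y).
Hypothesis lipp : forall k (x y : 'rV[R]_M), sqnorm ((x - (mu * eta) *: grad (p k) x) -
  (y - (mu * eta) *: grad (p k) y)) <= 1 * sqnorm (x - y).
Hypothesis noise : gradient_noise_model P w v alpha sigma_v2.
Hypothesis diffusion : penalized_diffusion w v nbh J p A1 A2 mu eta.

Let step_J k (x : 'rV[R]_M) : 'rV[R]_M := x - mu *: grad (J k) x.
Let step_p k (x : 'rV[R]_M) : 'rV[R]_M := x - (mu * eta) *: grad (p k) x.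

Lemma sum_nbh (A : 'M[R]_N) (x : 'I_N -> 'rV[R]_M) k :
  (forall l k, l \notin nbh k -> A l k = 0) ->
  \sum_(l in nbh k) A l k *: x l = \sum_l A l k *: x l.
Proof.
move=> A0; rewrite [RHS](bigID (mem (nbh k)))/= [X in _ = _ + X]big1 ?addr0//.
by move=> l lk; rewrite A0// scale0r.
Qed.

Lemma continuous_grad_step (f : 'rV[R]_M -> R) (c : R) :
  continuous (grad f) -> continuous (fun x : 'rV[R]_M => x - c *: grad f x).
Proof.
move=> cf x; have cx : {for x, continuous (c *: grad f)}.
  by apply: continuousZl_tmp; exact: cf.
by apply: (@continuousB _ _ _ id (c *: grad f) x) => //; exact: cx.
Qed.

Definition mixed_point (W : 'I_N -> 'rV[R]_M) l := \sum_m A1 m l *: W m.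

(** The displacement of [W] under one noiseless round of the whole network; it vanishes for all [k]
    exactly at fixed points of that map. *)
Definition network_defect (W : 'I_N -> 'rV[R]_M) k :=
  \sum_l A2 l k *: (step_p l (step_J l (mixed_point W l))) - W k.

Lemma history_measurable i :
  (forall k j, (j <= i)%N -> random_vector (w k j)) ->
  history w i `<=` measurable.
Proof.
move=> mw; apply: smallest_sub; first exact: sigma_algebra_measurable.
by move=> _ [k [j [c [B [ji mB ->]]]]]; exact: mw.
Qed.

Lemma iterate_history k i : measurable_wrt (history w i) (w k i).
Proof.
move=> c B mB; apply: sub_sigma_algebra.
by exists k, i, c, B.
Qed.

(** The error against [W] is followed through first mixing, noisy gradient step, penalty step and
    second mixing. Integrability is proved alongside, since the noise model speaks only of
    square-integrable points. *)
Lemma one_step (W : 'I_N -> 'rV[R]_M) i :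
  (forall k j, (j <= i)%N -> random_vector (w k j)) ->
  (forall k, sqint P (w k i)) ->
  (forall k, sqint P (w k i.+1)) /\
  forall e, 0 < e ->
  \sum_k Esq P (fun t => w k i.+1 t - W k) <=
  (1 + e) * ((q + 2 * alpha * mu ^+ 2) * \sum_k Esq P (fun t => w k i t - W k)
     + mu ^+ 2 * (2 * alpha * \sum_k sqnorm (mixed_point W k) + N%:R * sigma_v2))
  + (1 + e^-1) * \sum_k sqnorm (network_defect W k).
Proof.
move=> mw iw.
have gm := history_measurable i mw.
pose gen := [set E | exists k j c (B : set R),
         [/\ (j <= i)%N, measurable B & E = (fun t => w k j t 0 c) @^-1` B]].
(* Lemmas on random vectors instantiated at [T'] yield measurability with respect to the history. *)
pose T' := g_sigma_algebraType gen.
pose ph k t := phi w nbh A1 k i t.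
have phE k t : ph k t = \sum_l A1 l k *: w l i t by rewrite /ph/phi sum_nbh.
have phE' k : ph k = fun t => \sum_l A1 l k *: w l i t by apply/funext => t.
have hph k : random_vector (T := T') (ph k).
  rewrite phE'; apply: random_vector_sum => l; apply: random_vectorZ.
  exact: iterate_history.
have iph k : sqint P (ph k).
  by rewrite phE'; apply: sqint_sum => l; exact: sqintZ.
pose V k t := v k i.+1 (ph k t) t.
have phoo k : (mean_square P (ph k) < +oo)%E by rewrite mean_squareE// ltry.
have Vnoise k := noise k i (ph k) (hph k) (phoo k).
have iV k : sqint P (V k).
  have [mV _ leV] := Vnoise k; apply: sqintP => //.
  by apply: (le_lt_trans leV); rewrite mean_squareE// -EFinM -EFinD ltry.
have EV k : Esq P (V k) <= alpha * Esq P (ph k) + sigma_v2.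
  have [_ _ leV] := Vnoise k; rewrite -lee_fin EFinD EFinM.
  by rewrite -(mean_squareE _ _ (iV k)) -(mean_squareE _ _ (iph k)).
pose m := mixed_point W.
pose X k t := step_J k (ph k t) - step_J k (m k).
have cJ k : continuous (step_J k) by exact: continuous_grad_step.
have cp k : continuous (step_p k) by exact: continuous_grad_step.
have hX k : random_vector (T := T') (X k).
  apply: random_vectorB; last exact: random_vector_cst.
  exact: (random_vector_continuous_comp (T := T') (step_J k) (ph k)).
have iJ k : sqint P (step_J k \o ph k).
  exact: (sqint_lipschitz P (step_J k) q (ph k) (cJ k) (lipJ k) (iph k)).
have iX k : sqint P (X k).
  exact: (sqintB P _ _ (iJ k) (sqint_cst P (step_J k (m k)))).
have iD k : sqint P (fun t => ph k t - m k).
  exact: (sqintB P _ _ (iph k) (sqint_cst P (m k))).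
have EX : forall k, Esq P (fun t => X k t - mu *: V k t) <=
    (q + 2 * alpha * mu ^+ 2) * Esq P (fun t => ph k t - m k)
    + mu ^+ 2 * (2 * alpha * sqnorm (m k) + sigma_v2).
  move=> k; have [_ cV _] := Vnoise k.
  (* [X k] depends only on the past, so the noise contributes just its variance. *)
  rewrite (Esq_orthogonal P gen (X k) (V k) mu gm (hX k) (iX k) (iV k) cV).
  have h1 : Esq P (X k) <= q * Esq P (fun t => ph k t - m k).
    rewrite -[leRHS]addr0 -[X in _ + X](mul0r (Rintegral P setT (fun=> 0))).
    rewrite -Rintegral_lin; [|exact: (iD k).2|exact: integrable_const].
    apply: Esq_le => //.
      by apply: integrable_lin; [exact: (iD k).2|exact: integrable_const].
    by move=> t; rewrite mul0r addr0; exact: lipJ.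
  (* The noise variance is bounded through [ph k] itself; recentring it at [m k] costs the factor 2
     in [2 * alpha]. *)
  have h2 : Esq P (ph k) <= 2 * Esq P (fun t => ph k t - m k) + 2 * sqnorm (m k).
    rewrite -(Rintegral_const P (sqnorm (m k))).
    rewrite -Rintegral_lin; [|exact: (iD k).2|exact: integrable_const].
    apply: Esq_le => //.
      by apply: integrable_lin; [exact: (iD k).2|exact: integrable_const].
    by move=> t; rewrite -{1}(subrK (m k) (ph k t)); exact: sqnormD_le2.
  have h3 := ler_wpM2l alpha_ge0 h2.
  have h4 : Esq P (V k) <= 2 * alpha * Esq P (fun t => ph k t - m k) +
    (2 * alpha * sqnorm (m k) + sigma_v2).
    by have := EV k; lra.
  have := ler_wpM2l (sqr_ge0 mu) h4; lra.
pose z k t := zeta w v nbh J A1 mu k i t.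
have zE l s : z l s - step_J l (m l) = X l s - mu *: V l s.
  by rewrite /z /zeta /X /step_J scalerDr /V /ph opprD !addrA; rewrite [LHS]addrAC.
have iz k : sqint P (z k).
  rewrite (_ : z k = fun t => step_J k (ph k t) - mu *: V k t).
    exact: (sqintB P _ _ (iJ k) (sqintZ P mu _ (iV k))).
  by apply/funext => t; rewrite /z /zeta /step_J /V /ph scalerDr opprD addrA.
pose ps k t := psi w v nbh J p A1 mu eta k i t.
have ips k : sqint P (ps k).
  exact: (sqint_lipschitz P (step_p k) 1 (z k) (cp k) (lipp k) (iz k)).
have wE k : w k i.+1 = fun t => \sum_l A2 l k *: ps l t.
  by apply/funext => t; rewrite diffusion sum_nbh.
have iw' k : sqint P (w k i.+1).
  by rewrite wE; apply: sqint_sum => l; exact: sqintZ.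
split=> // e e0.
pose ps0 l := step_p l (step_J l (m l)).

have iXV k : sqint P (fun t => X k t - mu *: V k t).
  exact: (sqintB P _ _ (iX k) (sqintZ P mu _ (iV k))).
have iw0 k : sqint P (fun t => w k i t - W k).
  exact: (sqintB P _ _ (iw k) (sqint_cst P (W k))).
have i1 k : sqint P (fun t => w k i.+1 t - W k).
  exact: (sqintB P _ _ (iw' k) (sqint_cst P (W k))).
have S1 : \sum_k Esq P (fun t => w k i.+1 t - W k) <=
    (1 + e) * (\sum_k Esq P (fun t => X k t - mu *: V k t))
    + (1 + e^-1) * \sum_k sqnorm (network_defect W k).
  rewrite -!Rintegral_sum; [|by move=> k; exact: (iXV k).2|by move=> k; exact: (i1 k).2].
  rewrite -(Rintegral_const P (\sum_k sqnorm (network_defect W k))).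
  have I1 := integrable_rsum P 'I_N (index_enum _) _ (fun k => (iXV k).2).
  rewrite -Rintegral_lin; [|exact: I1|exact: integrable_const].
  apply: le_Rintegral => //.
  - exact: (integrable_rsum P 'I_N (index_enum _) _ (fun k => (i1 k).2)).
  - by apply: integrable_lin; [exact: I1|exact: integrable_const].
  move=> t _.
  (* Young's inequality separates the defect from the mixed errors; the second mixing and the
     nonexpansive penalty step then do not increase the sum of squares. *)
  apply: (@le_trans _ _ (\sum_k ((1 + e) * sqnorm (\sum_l A2 l k *: (ps l t - ps0 l))
     + (1 + e^-1) * sqnorm (network_defect W k)))).
    apply: ler_sum => k _.
    suff -> : w k i.+1 t - W k = \sum_l A2 l k *: (ps l t - ps0 l) + network_defect W k.
      exact: sqnormD_young.
    rewrite wE /network_defect addrA; congr (_ - _).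
    rewrite -big_split/=; apply: eq_bigr => l _.
    by rewrite -scalerDr subrK.
  rewrite big_split/= -!mulr_sumr lerD2r ler_wpM2l//; first by rewrite ltW// addr_gt0.
  apply: (le_trans (sum_sqnorm_mix _ _ A2_ds)); apply: ler_sum => l _.
  by rewrite -zE -[leRHS]mul1r; exact: lipp.
apply: (le_trans S1); rewrite lerD2r ler_wpM2l//; first by rewrite ltW// addr_gt0.
apply: (le_trans (ler_sum _ (fun k _ => EX k))).
rewrite big_split/= -!mulr_sumr big_split/= -mulr_sumr sumr_const card_ord.
rewrite -[sigma_v2 *+ N]mulr_natl.
rewrite lerD2r; apply: ler_wpM2l.
  by rewrite addr_ge0// mulr_ge0 ?sqr_ge0// mulr_ge0.
rewrite -!Rintegral_sum; [|by move=> k; exact: (iw0 k).2|by move=> k; exact: (iD k).2].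
apply: le_Rintegral => //.
- exact: (integrable_rsum P 'I_N (index_enum _) _ (fun k => (iD k).2)).
- exact: (integrable_rsum P 'I_N (index_enum _) _ (fun k => (iw0 k).2)).
move=> t _.
(* The first mixing is removed pointwise, before integration. *)
apply: le_trans (sum_sqnorm_mix _ (fun k => w k i t - W k) A1_ds).
apply: ler_sum => k _; rewrite phE /m /mixed_point -sumrB.
by under eq_bigr => l _ do rewrite -scalerBr.
Qed.

Hypothesis init : forall k, random_vector (w k 0%N) /\
  (mean_square P (w k 0%N) < +oo)%E.

Lemma iterates_sqint i :
  (forall k j, (j <= i)%N -> random_vector (w k j)) /\
  (forall k, sqint P (w k i)).
Proof.
elim: i => [|i [mw iw]].
  split=> [k j|k]; last by have [] := init k; exact: sqintP.
  by rewrite leqn0 => /eqP ->; have [] := init k.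
(* Only integrability is extracted, so any reference point will do. *)
have [iw' _] := one_step (fun=> 0) i mw iw.
split=> // k j; rewrite leq_eqVlt => /predU1P[->|ji]; first exact: (iw' k).1.
exact: mw.
Qed.

(** Iterating [one_step] brings the summed error within [delta] of the fixed point of the affine
    recursion. One agent's error is at most the sum, and moving the reference from [W k] to [x]
    costs a factor 2. *)
Lemma limsup_mean_square_le (W : 'I_N -> 'rV[R]_M) (x : 'rV[R]_M)
    (e beta delta : R) k :
  0 < e -> 0 < delta -> beta < 1 ->
  (1 + e) * (q + 2 * alpha * mu ^+ 2) <= beta ->
  (limn_esup (fun i => mean_square P (fun t => (x - w k i t)%R)) <=
   (2 * (((1 + e) * (mu ^+ 2 *
            (2 * alpha * \sum_k sqnorm (mixed_point W k) + N%:R * sigma_v2))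
          + (1 + e^-1) * \sum_k sqnorm (network_defect W k)) / (1 - beta)
         + delta) + 2 * sqnorm (x - W k))%:E)%E.
Proof.
move=> e0 delta0 beta1 eb; set c := (1 + e) * _ + _.
pose S i := \sum_k Esq P (fun t => w k i t - W k).
have S0 i : 0 <= S i by apply: sumr_ge0 => l _; exact: Esq_ge0.
have beta0 : 0 <= beta.
  apply: le_trans eb; rewrite mulr_ge0//; first by rewrite addr_ge0// ltW.
  by rewrite addr_ge0// mulr_ge0 ?sqr_ge0// mulr_ge0.
have Srec i : S i.+1 <= beta * S i + c.
  have [mw iw] := iterates_sqint i.
  have [_ /(_ e e0)] := one_step W i mw iw.
  rewrite -/(S i) -/(S i.+1) => /le_trans; apply.
  by rewrite mulrDr -addrA -/c mulrA lerD2r ler_wpM2r.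
have Sn := affine_recursion_bound S beta c beta0 beta1 Srec delta delta0.
apply: limn_esup_le_near; near=> i.
have iw := (iterates_sqint i).2 k.
have iD := sqintB P _ _ iw (sqint_cst P (W k)).
rewrite (mean_squareE _ _ (sqintB P _ _ (sqint_cst P x) iw)) lee_fin.
apply: (@le_trans _ _ (2 * S i + 2 * sqnorm (x - W k))); last first.
  by rewrite lerD2r ler_pM2l//; near: i; exact: Sn.
apply: (@le_trans _ _ (2 * Esq P (fun t => w k i t - W k) + 2 * sqnorm (x - W k))).
  rewrite -(Rintegral_const P (sqnorm (x - W k))).
  rewrite -Rintegral_lin; [|exact: iD.2|exact: integrable_const].
  apply: Esq_le; first exact: (sqintB P _ _ (sqint_cst P x) iw).
    by apply: integrable_lin; [exact: iD.2|exact: integrable_const].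
  move=> t; rewrite (sqnormBC (w k i t)).
  rewrite (_ : x - w k i t = (W k - w k i t) + (x - W k)).
    exact: sqnormD_le2.
  by rewrite [RHS]addrC addrA subrK.
rewrite lerD2r ler_pM2l// /S (bigD1 k)//= lerDl.
by apply: sumr_ge0 => l _; exact: Esq_ge0.
Unshelve. all: by end_near. Qed.

End OneStep.

(** * The defect of the corrected reference points *)

Section Defect.
Context {R : realType} {N M : nat}.
Variables (J p : 'I_N -> 'rV[R]_M -> R) (A1 A2 : 'M[R]_N) (eta : R)
  (LJ Lp : 'I_N -> R) (wo : 'rV[R]_M) (z : 'I_N -> 'rV[R]_M).
Hypotheses (A1_ds : doubly_stochastic A1) (A2_ds : doubly_stochastic A2).
Hypothesis lipJ : forall k (x y : 'rV[R]_M),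
  sqnorm (grad (J k) x - grad (J k) y) <= LJ k ^+ 2 * sqnorm (x - y).
Hypothesis lipp : forall k (x y : 'rV[R]_M),
  sqnorm (grad (p k) x - grad (p k) y) <= Lp k ^+ 2 * sqnorm (x - y).
Hypothesis zE : forall k, z k = \sum_l A2 l k *: (\sum_m A1 m l *: z m -
  (grad (J l) wo + eta *: grad (p l) wo)).

(** To first order the noiseless step sends [wo + mu y] to [wo + mu (y - b)], with [b] the penalized
    gradient at [wo]. The remainder is [mu] times differences of gradients at points within O([mu])
    of [wo], hence O([mu ^+ 2]) by the Lipschitz bounds. *)
Lemma agent_defect_le (mu : R) k (x y u : 'rV[R]_M) : 0 <= mu <= 1 ->
  x = wo + mu *: y -> u = x - mu *: grad (J k) x ->
  sqnorm (u - (mu * eta) *: grad (p k) u -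
    (wo + mu *: (y - (grad (J k) wo + eta *: grad (p k) wo)))) <=
  mu ^+ 4 * (2 * LJ k ^+ 2 * sqnorm y + 2 * eta ^+ 2 * Lp k ^+ 2 *
    (2 * sqnorm y + 2 * (2 * LJ k ^+ 2 * sqnorm y + 2 * sqnorm (grad (J k) wo)))).
Proof.
move=> /andP[mu0 mu1] xE uE.
have xwo : x - wo = mu *: y by rewrite xE addrC addKr.
have hJ := lipJ k x wo; have hp := lipp k u wo.
rewrite xwo sqnormZ in hJ.
have mu2 : mu ^+ 2 <= 1 by rewrite expr_le1.
have m20 := sqr_ge0 mu.
have y0 := sqnorm_ge0 y.
have hG : sqnorm (grad (J k) x) <= 2 * LJ k ^+ 2 * sqnorm y + 2 * sqnorm (grad (J k) wo).
  rewrite -[in leLHS](subrK (grad (J k) wo) (grad (J k) x)).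
  apply: (le_trans (sqnormD_le2 _ _)); rewrite lerD2r -mulrA ler_pM2l//.
  apply: (le_trans hJ); rewrite ler_wpM2l ?sqr_ge0//.
  by rewrite -[leRHS]mul1r ler_wpM2r.
have hu : sqnorm (u - wo) <= mu ^+ 2 *
    (2 * sqnorm y + 2 * (2 * LJ k ^+ 2 * sqnorm y + 2 * sqnorm (grad (J k) wo))).
  rewrite (_ : u - wo = mu *: (y - grad (J k) x)); last first.
    by rewrite uE addrAC xwo -scalerBr.
  rewrite sqnormZ ler_wpM2l//; apply: (le_trans (sqnormD_le2 _ _)).
  by rewrite sqnormN lerD2l ler_pM2l.
rewrite (_ : u - _ - _ = - (mu *: ((grad (J k) x - grad (J k) wo) +
    eta *: (grad (p k) u - grad (p k) wo)))); last first.
  rewrite {1}uE {1}xE; apply/rowP => j; rewrite !mxE; ring.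
rewrite sqnormN sqnormZ (_ : mu ^+ 4 = mu ^+ 2 * mu ^+ 2); last by ring.
rewrite -[leRHS]mulrA ler_wpM2l//; apply: (le_trans (sqnormD_le2 _ _)).
rewrite sqnormZ.
have hb := ler_wpM2l (sqr_ge0 eta)
  (le_trans hp (ler_wpM2l (sqr_ge0 (Lp k)) hu)).
have ineq (a b Y G j2 p2 e2 m2 : R) : a <= j2 * (m2 * Y) ->
    e2 * b <= e2 * (p2 * (m2 * (2 * Y + 2 * (2 * j2 * Y + 2 * G)))) ->
    2 * a + 2 * (e2 * b) <= m2 * (2 * j2 * Y +
      2 * e2 * p2 * (2 * Y + 2 * (2 * j2 * Y + 2 * G))).
  move=> ha hb'; have := lerD (ler_wpM2l (ler0n R 2) ha) (ler_wpM2l (ler0n R 2) hb').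
  by move=> /le_trans; apply; rewrite le_eqVlt; apply/orP; left; apply/eqP; ring.
exact: ineq hJ hb.
Qed.

(** The equation for [z] cancels all terms up to first order in [mu], so the defect is the
    [A2]-mixture of the agents' remainders [r]. *)
Lemma network_defect_le : exists2 C, 0 <= C & forall mu, 0 <= mu <= 1 ->
  \sum_k sqnorm (network_defect J p A1 A2 mu eta (fun k => wo + mu *: z k) k)
  <= C * mu ^+ 4.
Proof.
pose y l := \sum_m A1 m l *: z m.
pose K k := 2 * LJ k ^+ 2 * sqnorm (y k) + 2 * eta ^+ 2 * Lp k ^+ 2 *
    (2 * sqnorm (y k) + 2 * (2 * LJ k ^+ 2 * sqnorm (y k) + 2 * sqnorm (grad (J k) wo))).
exists (\sum_k K k).
  apply: sumr_ge0 => k _; rewrite /K.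
  repeat first [exact: sqr_ge0 | exact: sqnorm_ge0 | exact: ler0n
    | apply: addr_ge0 | apply: mulr_ge0].
move=> mu mu01.
have mE l : mixed_point A1 (fun k => wo + mu *: z k) l = wo + mu *: y l.
  rewrite /mixed_point; under eq_bigr => m _ do rewrite scalerDr.
  rewrite big_split/= mix_const//; congr (_ + _).
  by rewrite scaler_sumr; apply: eq_bigr => m _; rewrite !scalerA mulrC.
pose x l := wo + mu *: y l; pose u l := x l - mu *: grad (J l) (x l).
pose r l := u l - (mu * eta) *: grad (p l) (u l) -
    (wo + mu *: (y l - (grad (J l) wo + eta *: grad (p l) wo))).
apply: (@le_trans _ _ (\sum_k sqnorm (\sum_l A2 l k *: r l))).
  apply: ler_sum => k _; rewrite le_eqVlt; apply/orP; left; apply/eqP; congr sqnorm.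
  rewrite /network_defect; under eq_bigr => l _ do rewrite mE.
  rewrite -/(x _) {1}zE.
  under [RHS]eq_bigr => l _ do rewrite /r scalerBr.
  rewrite sumrB; congr (_ - _).
  under [RHS]eq_bigr => l _ do rewrite scalerDr.
  rewrite big_split/= mix_const//; congr (_ + _).
  by rewrite scaler_sumr; apply: eq_bigr => l _; rewrite !scalerA mulrC.
apply: (le_trans (sum_sqnorm_mix _ _ A2_ds)).
rewrite mulr_suml; apply: ler_sum => l _; rewrite mulrC.
exact: (agent_defect_le mu l (x l) (y l) (u l) mu01 erefl erefl).
Qed.

End Defect.

(** * Step-size thresholds and rates *)

Section StepSizes.
Context {R : realType} {N : nat}.

(** [k0] supplies the initial value of the maximum, which keeps it below [b]. *)
Lemma finite_strict_bound (f : 'I_N -> R) (b : R) (k0 : 'I_N) :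
  (forall k, f k < b) -> exists2 q, q < b & forall k, f k <= q.
Proof.
move=> fb; exists (\big[Num.max/f k0]_k f k); first by apply: bigmax_lt.
by move=> k; apply: le_bigmax.
Qed.

Lemma finite_positive_bound (f : 'I_N -> R) : (forall k, 0 < f k) ->
  exists2 m, 0 < m & forall k, m <= f k.
Proof.
move=> f0; exists (\big[Num.min/1]_k f k); first by apply: lt_bigmin.
by move=> k; exact: bigmin_le.
Qed.

(** The source of the step-size threshold: it says that [mu ^+ 2 * (l ^+ 2 + 2 * a)] is less than
    [2 * mu * l], so contraction outweighs the noise gain. *)
Lemma contraction_factor_lt1 (l a mu : R) : 0 < l -> 0 <= a -> 0 < mu ->
  mu < 2 * l / (l ^+ 2 + 2 * a) -> (1 - mu * l) ^+ 2 < 1 - 2 * a * mu ^+ 2.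
Proof.
move=> l0 a0 mu0; have d0 : 0 < l ^+ 2 + 2 * a by rewrite ltr_wpDr ?mulr_ge0// exprn_gt0.
rewrite ltr_pdivlMr// => h.
have := ltr_pM2l mu0; move/(_ (mu * (l ^+ 2 + 2 * a)) (2 * l)); rewrite h.
by lra.
Qed.

(** Up to half of the threshold the quadratic terms consume at most half of [2 * mu * l], which
    leaves a margin linear in [mu]. *)
Lemma contraction_factor_rate (l0 l a mu : R) : 0 < l -> 0 <= a -> 0 <= mu ->
  l0 <= l -> mu <= l / (l ^+ 2 + 2 * a) ->
  (1 - mu * l) ^+ 2 <= 1 - l0 * mu - 2 * a * mu ^+ 2.
Proof.
move=> lp a0 mu0 l0l; have d0 : 0 < l ^+ 2 + 2 * a.
  by rewrite ltr_wpDr ?mulr_ge0// exprn_gt0.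
rewrite ler_pdivlMr// => h.
have h1 := ler_wpM2l mu0 h; have h2 := ler_wpM2l mu0 l0l.
by lra.
Qed.

(** Order count: with Young weight [l * mu / 2], noise enters at order 2 and the defect at order 3,
    since its weight is of order -1. Dividing by a gap of order 1 leaves orders 1 and 2. The slack
    [mu] and the squared distance [s] fit as well. *)
Lemma rate_bound (l mu Sw Cw D C s Z : R) : 0 < l -> 0 < mu -> mu <= 1 ->
  l * mu <= 1 -> 0 <= Sw <= Cw -> D <= C * mu ^+ 4 -> 0 <= C ->
  s <= mu ^+ 2 * Z -> 0 <= Z ->
  2 * (((1 + l * mu / 2) * (mu ^+ 2 * Sw) + (1 + (l * mu / 2)^-1) * D)
        / (1 - (1 - l * mu / 2)) + mu) + 2 * s <=
  (2 * (4 * Cw / l + 2 * C / l + 4 * C / l ^+ 2 + 1) + 2 * Z) * mu.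
Proof.
move=> l0 mu0 mu1 lmu /andP[Sw0 SwC] DC C0 sZ Z0.
have lmu0 : 0 < l * mu by exact: mulr_gt0.
have ln : l != 0 by rewrite gt_eqF. have mn : mu != 0 by rewrite gt_eqF.
have mu2 : mu ^+ 2 <= mu by rewrite expr2 ler_piMl// ltW.
have mu3 : mu ^+ 3 <= mu by rewrite exprS ler_piMr ?(ltW mu0)// (le_trans mu2).
have h1 : (1 + l * mu / 2) * (mu ^+ 2 * Sw) <= 2 * (mu ^+ 2 * Cw).
  apply: ler_pM; [lra|by rewrite mulr_ge0// sqr_ge0|lra|].
  by rewrite ler_wpM2l// sqr_ge0.
have i0 : 0 < (l * mu / 2)^-1 by rewrite invr_gt0 divr_gt0.
have h2 : (1 + (l * mu / 2)^-1) * D <= (1 + (l * mu / 2)^-1) * (C * mu ^+ 4).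
  by rewrite ler_wpM2l// addr_ge0// ltW.
have h3 : ((1 + l * mu / 2) * (mu ^+ 2 * Sw) + (1 + (l * mu / 2)^-1) * D)
    / (1 - (1 - l * mu / 2)) <=
    (2 * (mu ^+ 2 * Cw) + (1 + (l * mu / 2)^-1) * (C * mu ^+ 4)) / (l * mu / 2).
  rewrite (_ : 1 - (1 - l * mu / 2) = l * mu / 2); last by ring.
  by rewrite ler_pM2r//; exact: lerD.
have h4 : (2 * (mu ^+ 2 * Cw) + (1 + (l * mu / 2)^-1) * (C * mu ^+ 4)) / (l * mu / 2)
    = 4 * Cw / l * mu + 2 * C / l * mu ^+ 3 + 4 * C / l ^+ 2 * mu ^+ 2.
  by field; rewrite ln mn.
have h5 : 2 * C / l * mu ^+ 3 <= 2 * C / l * mu.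
  by rewrite ler_wpM2l// divr_ge0 ?mulr_ge0// ltW.
have h6 : 4 * C / l ^+ 2 * mu ^+ 2 <= 4 * C / l ^+ 2 * mu.
  by apply: ler_wpM2l => //; apply: divr_ge0; [exact: mulr_ge0|exact: sqr_ge0].
have h7 : mu ^+ 2 * Z <= mu * Z by rewrite ler_wpM2r.
rewrite h4 in h3.
move: h3 h5 h6; set a := _ / (1 - _); set b := 2 * C / l; set c := 4 * C / l ^+ 2.
set f := 4 * Cw / l; lra.
Qed.

Lemma step_size_ok_small (lmin lmax lpmax : 'I_N -> R) (alpha eta : R) :
  (forall k, 0 < lmin k) -> (forall k, 0 < lmax k) -> (forall k, 0 < lpmax k) ->
  0 <= alpha -> 0 < eta ->
  exists2 m, 0 < m & forall mu, 0 < mu < m ->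
    step_size_ok lmin lmax lpmax alpha eta mu.
Proof.
move=> lmin0 lmax0 lp0 a0 eta0.
have d0 (l : R) : 0 < l -> 0 < 2 * l / (l ^+ 2 + 2 * alpha).
  by move=> l0; rewrite divr_gt0 ?mulr_gt0// ltr_wpDr ?mulr_ge0// exprn_gt0.
have [|m m0 mle] := finite_positive_bound (fun k =>
    Num.min (2 * lmax k / (lmax k ^+ 2 + 2 * alpha))
        (Num.min (2 * lmin k / (lmin k ^+ 2 + 2 * alpha))
                 (2 / (eta * lpmax k)))).
  by move=> k; rewrite !lt_min !d0//= divr_gt0// mulr_gt0.
exists m => // mu /andP[mu0 mum]; split=> // k.
exact: lt_le_trans (mle k).
Qed.

End StepSizes.

(** * Stability, rate and limit *)

Lemma loewner_le_scalar_ge0 {R : realType} {M : nat} (a : R) (X : 'M[R]_M) :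
  0 <= a -> loewner_le a%:M X -> loewner_le 0 X.
Proof.
move=> a0 /psd_scalarB[Xt Xa]; split=> [|x]; first by rewrite subr0.
by rewrite subr0 (le_trans _ (Xa x))// mulr_ge0// sqnorm_ge0.
Qed.

Theorem theorem2 (R : realType) (N M : nat)
  (nbh : 'I_N -> {set 'I_N}) (nbh_refl : forall k, k \in nbh k)
  (J : 'I_N -> 'rV[R]_M -> R)
  (J_diff : forall k, twice_differentiable (J k))
  (J_convex : forall k, strongly_convex (J k))
  (U L : 'I_N -> nat)
  (h : forall k, 'I_(U k) -> 'rV[R]_M -> R)
  (g : forall k, 'I_(L k) -> 'rV[R]_M -> R)
  (h_affine : forall k u, affine_fun (h k u))
  (g_convex : forall k l, convex_fun (g k l))
  (dIP dEP : R -> R)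
  (dIP_pen : inequality_penalty dIP) (dEP_pen : equality_penalty dEP)
  (p : 'I_N -> 'rV[R]_M -> R)
  (p_def : p = penalty h g dIP dEP)
  (p_diff : forall k, twice_differentiable (p k))
  (p_convex : forall k, convex_fun (p k))
  (p_grad0 : forall k w', global_feasible h g w' -> grad (p k) w' = 0)
  (eta : R) (eta_gt0 : 0 < eta)
  (wo : 'rV[R]_M) (wo_min : unique_minimizer (glob_cost J p eta) wo)
  (* (i) *)
  (lmin lmax : 'I_N -> R)
  (lmin_gt0 : forall k, 0 < lmin k) (lmax_gt0 : forall k, 0 < lmax k)
  (hess_J : forall k w, loewner_le (lmin k)%:M (hess (J k) w) /\
                        loewner_le (hess (J k) w) (lmax k)%:M)
  (* (ii) *)
  (lpmax : 'I_N -> R) (lpmax_gt0 : forall k, 0 < lpmax k)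
  (hess_p : forall k w, loewner_le 0 (hess (p k) w) /\
                        loewner_le (hess (p k) w) (lpmax k)%:M)
  (* (iii) *)
  (A A1 A2 : 'M[R]_N)
  (A_nbh : forall l k, l \notin nbh k -> A l k = 0)
  (A_prim : primitive_mx A) (A_ds : doubly_stochastic A)
  (A12 : (A1, A2) = (1%:M, A) \/ (A1, A2) = (A, 1%:M))
  (* the strategy, run for each admissible step-size mu, and (iv) *)
  (alpha sigma_v2 : R) (alpha_ge0 : 0 <= alpha) (sigma_v2_ge0 : 0 <= sigma_v2)
  (d : measure_display) (T : measurableType d) (P : probability T R)
  (w : R -> 'I_N -> nat -> T -> 'rV[R]_M)
  (v : R -> 'I_N -> nat -> 'rV[R]_M -> T -> 'rV[R]_M)
  (w_init : forall mu, step_size_ok lmin lmax lpmax alpha eta mu ->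
     forall k, random_vector (w mu k 0%N) /\
               (mean_square P (w mu k 0%N) < +oo)%E)
  (w_diffusion : forall mu, step_size_ok lmin lmax lpmax alpha eta mu ->
     penalized_diffusion (w mu) (v mu) nbh J p A1 A2 mu eta)
  (v_noise : forall mu, step_size_ok lmin lmax lpmax alpha eta mu ->
     gradient_noise_model P (w mu) (v mu) alpha sigma_v2) :
  let msd mu k := limn_esup (fun i => mean_square P (fun t => wo - w mu k i t)) in
  [/\ (forall mu k, step_size_ok lmin lmax lpmax alpha eta mu ->
         (msd mu k < +oo)%E),
      (exists C1 C2 mu0 : R, [/\ 0 <= C1, 0 <= C2, 0 < mu0 &
         forall mu k, step_size_ok lmin lmax lpmax alpha eta mu -> mu < mu0 ->
           (msd mu k <= (C1 * mu + C2 * (eta * mu) ^+ 2)%:E)%E])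
    & (forall k, msd mu k @[mu --> 0^'+] --> 0%E)].
Proof.
have [A1_ds A2_ds] : doubly_stochastic A1 /\ doubly_stochastic A2.
  by case: A12 => -[-> ->]; split=> //; exact: doubly_stochastic1.
have I_nbh l k : l \notin nbh k -> (1%:M : 'M[R]_N) l k = 0.
  by move=> lk; rewrite mxE; case: eqP lk => // ->; rewrite nbh_refl.
have [A1_nbh A2_nbh] : (forall l k, l \notin nbh k -> A1 l k = 0) /\
    (forall l k, l \notin nbh k -> A2 l k = 0).
  by case: A12 => -[-> ->].
have contJ k : continuous (grad (J k)).
  by move=> x; apply: differentiable_continuous; exact: (J_diff k).2.
have contp k : continuous (grad (p k)).
  by move=> x; apply: differentiable_continuous; exact: (p_diff k).2.
have lipJ k (x y : 'rV[R]_M) :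
    sqnorm (grad (J k) x - grad (J k) y) <= lmax k ^+ 2 * sqnorm (x - y).
  apply: lipschitz_grad => // [|u]; first exact: ltW.
  have [lo hi] := hess_J k u; split=> //.
  exact: loewner_le_scalar_ge0 (ltW (lmin_gt0 k)) lo.
have lipp k (x y : 'rV[R]_M) :
    sqnorm (grad (p k) x - grad (p k) y) <= lpmax k ^+ 2 * sqnorm (x - y).
  by apply: lipschitz_grad => //; exact: ltW.
pose K mu (W : 'I_N -> 'rV[R]_M) e beta delta := ((2 * (((1 + e) * (mu ^+ 2 *
            (2 * alpha * \sum_k sqnorm (mixed_point A1 W k) + N%:R * sigma_v2))
          + (1 + e^-1) * \sum_k sqnorm (network_defect J p A1 A2 mu eta W k)) / (1 - beta)
         + delta)))%R.
move=> msd.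
have bound mu k q (W : 'I_N -> 'rV[R]_M) e beta delta :
    step_size_ok lmin lmax lpmax alpha eta mu ->
    0 <= q -> (forall k, (1 - mu * lmin k) ^+ 2 <= q) ->
    (forall k, (1 - mu * lmax k) ^+ 2 <= q) ->
    0 < e -> 0 < delta -> beta < 1 ->
    (1 + e) * (q + 2 * alpha * mu ^+ 2) <= beta ->
    (msd mu k <= (K mu W e beta delta + 2 * sqnorm (wo - W k))%R%:E)%E.
  move=> ok q0 qlo qhi e0 delta0 beta1 eb.
  have [mu0 muk] := ok.
  apply: (limsup_mean_square_le P (w mu) (v mu) nbh J p A1 A2 mu eta alpha
    sigma_v2 q) => //.
  - by move=> l x y; apply: (lipschitz_grad_step _ (lmin l) (lmax l)) => //; exact: ltW.
  - move=> l x y; apply: (lipschitz_grad_step _ 0 (lpmax l)) => //.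
    + by rewrite mulr_ge0// ltW.
    + by move=> u; rewrite raddf0; exact: hess_p.
    + by rewrite mulr0 subr0 expr1n.
    (* The third threshold gives [mu * eta * lpmax l < 2], which makes the penalty step
       nonexpansive. *)
    + have := muk l; rewrite !lt_min => /and3P[_ _].
      rewrite ltr_pdivlMr ?mulr_gt0// => muh.
      have h0 : 0 <= mu * eta * lpmax l by rewrite !mulr_ge0// ltW.
      by rewrite -(expr1n _ 2) -real_normK ?num_real// ler_sqr ?nnegrE// ler_norml; lra.
  - exact: v_noise.
  - exact: w_diffusion.
  - exact: w_init.
have msd_ge0 mu k : (0 <= msd mu k)%E.
  apply: limf_esup_ge0; first exact: filter_not_empty.
  by move=> i; apply: expectation_ge0 => t; exact: sqr_ge0.
have am_ge0 mu : 0 <= 2 * alpha * mu ^+ 2.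
  by rewrite mulr_ge0 ?sqr_ge0// mulr_ge0.
have small : exists C1 mu0 : R, [/\ 0 <= C1, 0 < mu0 &
    forall mu k, step_size_ok lmin lmax lpmax alpha eta mu -> mu < mu0 ->
      (msd mu k <= (C1 * mu)%:E)%E].
  have [|z zE] := exists_network_correction A A1 A2
      (fun k => grad (J k) wo + eta *: grad (p k) wo) A_prim A_ds A12.
    apply: sum_grad_minimizer wo_min => [k y|k y]; first exact: (J_diff k).1.
    exact: (p_diff k).1.
  have [C C0 defect] := network_defect_le J p A1 A2 eta lmax lpmax wo z A1_ds
    A2_ds lipJ lipp zE.
  have [|l0 l0_gt0 l0_le] := finite_positive_bound (fun k => Num.min (lmin k) (lmax k)).
    by move=> k; rewrite lt_min lmin_gt0 lmax_gt0.
  have rate_gt0 (l : R) : 0 < l -> 0 < l / (l ^+ 2 + 2 * alpha).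
    by move=> lp; rewrite divr_gt0// ltr_wpDr ?mulr_ge0// exprn_gt0.
  (* Half of the first two thresholds, as [contraction_factor_rate] requires. *)
  have [|m m_gt0 m_le] := finite_positive_bound (fun k =>
      Num.min (lmin k / (lmin k ^+ 2 + 2 * alpha)) (lmax k / (lmax k ^+ 2 + 2 * alpha))).
    by move=> k; rewrite lt_min !rate_gt0.
  pose Z := \sum_k sqnorm (z k).
  have Z0 : 0 <= Z by apply: sumr_ge0 => k _; exact: sqnorm_ge0.
  (* Bounds the squared norms of the mixed reference points uniformly for [mu] up to 1. *)
  pose Sw := \sum_k (2 * sqnorm wo + 2 * sqnorm (z k)).
  have Sw0 : 0 <= Sw.
    by apply: sumr_ge0 => k _; rewrite addr_ge0 ?mulr_ge0 ?sqnorm_ge0.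
  pose Cw := 2 * alpha * Sw + N%:R * sigma_v2.
  have Cw0 : 0 <= Cw by rewrite addr_ge0 ?mulr_ge0.
  exists (2 * (4 * Cw / l0 + 2 * C / l0 + 4 * C / l0 ^+ 2 + 1) + 2 * Z), (Num.min 1 m).
  split.
  - have l0_ge0 := ltW l0_gt0.
    repeat first [exact: sqr_ge0 | exact: ler0n | exact: ler01 | exact: C0
      | exact: Cw0 | exact: Z0 | exact: l0_ge0 | apply: addr_ge0
      | apply: divr_ge0 | apply: mulr_ge0].
  - by rewrite lt_min ltr01.
  move=> mu k ok; rewrite lt_min => /andP[mu_lt1 mu_ltm]; have [mu_gt0 _] := ok.
  have mu01 : 0 <= mu <= 1 by rewrite !ltW.
  (* Chosen so that adding the noise gain gives [1 - l0 * mu]; the Young weight [l0 * mu / 2] then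
     spends half of this margin and leaves [beta = 1 - l0 * mu / 2]. *)
  pose q := 1 - l0 * mu - 2 * alpha * mu ^+ 2.
  have qlo l : (1 - mu * lmin l) ^+ 2 <= q.
    have := l0_le l; have := m_le l; rewrite !le_min => /andP[ml _] /andP[ll _].
    apply: contraction_factor_rate => //; first exact: ltW.
    by rewrite (le_trans _ ml)// ltW.
  have qhi l : (1 - mu * lmax l) ^+ 2 <= q.
    have := l0_le l; have := m_le l; rewrite !le_min => /andP[_ ml] /andP[_ ll].
    apply: contraction_factor_rate => //; first exact: ltW.
    by rewrite (le_trans _ ml)// ltW.
  have q0 : 0 <= q by rewrite (le_trans _ (qlo k))// sqr_ge0.
  have lmu0 : 0 < l0 * mu by exact: mulr_gt0.
  have lmu1 : l0 * mu <= 1.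
    by move: q0 (am_ge0 mu); rewrite /q; lra.
  pose W l := wo + mu *: z l.
  apply: le_trans (bound mu k q W (l0 * mu / 2) (1 - l0 * mu / 2) mu ok q0 qlo qhi
    _ mu_gt0 _ _) _.
  - by rewrite divr_gt0.
  - by lra.
  - by rewrite /q subrK; nra.
  rewrite lee_fin /K; apply: rate_bound => //; first exact: ltW.
  - apply/andP; split.
      rewrite addr_ge0 ?mulr_ge0// sumr_ge0// => l _; exact: sqnorm_ge0.
    rewrite lerD2r ler_wpM2l ?mulr_ge0//.
    apply: (le_trans (sum_sqnorm_mix _ _ A1_ds)); apply: ler_sum => l _.
    apply: (le_trans (sqnormD_le2 _ _)); rewrite lerD2l ler_pM2l// sqnormZ.
    by rewrite -[leRHS]mul1r ler_wpM2r ?sqnorm_ge0// expr_le1// ltW.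
  - exact: defect.
  - rewrite /W opprD addrA subrr add0r sqnormN sqnormZ ler_wpM2l ?sqr_ge0//.
    rewrite /Z (bigD1 k)//= lerDl sumr_ge0// => l _; exact: sqnorm_ge0.
have [C1 [mu0 [C1_ge0 mu0_gt0 C1_le]]] := small.
split.
(* On the whole admissible range only finiteness is claimed: reference point [wo], whose defect is
   just some constant, and slack 1. Finitely many strict inequalities leave a uniform [q]. *)
- move=> mu k ok; have [mu_gt0 muk] := ok.
  have [|q ql qle] := finite_strict_bound
    (fun l => Num.max ((1 - mu * lmin l) ^+ 2) ((1 - mu * lmax l) ^+ 2))
    (1 - 2 * alpha * mu ^+ 2) k.
    move=> l; have := muk l; rewrite !lt_min gt_max => /and3P[mumax mumin _].
    by rewrite !contraction_factor_lt1.
  have qlo l : (1 - mu * lmin l) ^+ 2 <= q.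
    by have := qle l; rewrite ge_max => /andP[].
  have qhi l : (1 - mu * lmax l) ^+ 2 <= q.
    by have := qle l; rewrite ge_max => /andP[].
  have q0 : 0 <= q by rewrite (le_trans _ (qlo k))// sqr_ge0.
  set kappa := q + 2 * alpha * mu ^+ 2.
  have kappa0 : 0 <= kappa by rewrite addr_ge0// am_ge0.
  have kappa1 : kappa < 1 by rewrite /kappa; lra.
  (* Small enough that [(1 + e) * kappa] stays below 1. *)
  pose e := (1 - kappa) / 2.
  apply: le_lt_trans (bound mu k q (fun=> wo) e ((1 + e) * kappa) 1 ok q0 qlo qhi
    _ ltr01 _ _) _ => //.
  - by rewrite /e; lra.
  - by rewrite /e; nra.
  - exact: ltry.
(* [C1] depends on [eta] through [z] and the defect constant, and the bound is already linear in
   [mu]; hence the witness 0. *)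
- exists C1, 0, mu0; split=> // mu k ok mu_lt.
  by rewrite mul0r addr0; exact: C1_le.
- move=> k.
  have [m m_gt0 m_ok] := step_size_ok_small lmin lmax lpmax alpha eta lmin_gt0
    lmax_gt0 lpmax_gt0 alpha_ge0 eta_gt0.
  (* Near 0 from the right every [mu] is admissible and below [mu0], so the limit is squeezed
     between 0 and [C1 * mu]. *)
  apply: (@squeeze_cvge _ _ _ _ (cst 0%E) _ (fun mu => (C1 * mu)%:E)).
  + near=> mu; rewrite msd_ge0/=; apply: C1_le; last by near: mu; exact: nbhs_right_lt.
    apply: m_ok; apply/andP; split; first by near: mu; exact: nbhs_right_gt.
    by near: mu; exact: nbhs_right_lt.
  + exact: cvg_cst.
  + apply: cvg_EFin; first exact: nearW.
    rewrite -[X in _ --> X](mulr0 C1); apply: cvgMl_tmp.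
    exact: cvg_at_right_filter.
Unshelve. all: by end_near. Qed.
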